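(* There exists $\varepsilon\in(0,1)$ such that the following holds. Let $u:\mathbb{Z}^2\to\mathbb{R}$ be a discrete harmonic function, and suppose that there is $N_0>0$ such that $$|Q_N\cap\{|u|\le 1\}|\ge (1-\varepsilon)|Q_N|\qquad\text{for all integers } N\ge N_0 .$$ Then $u$ is constant.
   Context: A function $u:\mathbb{Z}^2\to\mathbb{R}$ is discrete harmonic if its value at every point of $\mathbb{Z}^2$ equals the average of its values at the four adjacent points: $4u(n,m)=u(n+1,m)+u(n-1,m)+u(n,m+1)+u(n,m-1)$. For a positive integer $N$, $Q_N=\{(n,m)\in\mathbb{Z}^2: |n|,|m|\le N\}$. For a set $S\subset\mathbb{Z}^2$, $|S|$ denotes its number of elements, and $\{|u|\le 1\}$ is the set of points of $\mathbb{Z}^2$ where $|u|\le1$. *)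

(* Defs.v *)
From mathcomp Require Import all_boot all_order all_algebra.
From mathcomp Require Import finmap.
From mathcomp Require Import mathcomp_extra boolp classical_sets functions.
From mathcomp Require Import cardinality reals.

Set Implicit Arguments.
Unset Strict Implicit.
Unset Printing Implicit Defensive.
Import Order.TTheory GRing.Theory Num.Theory.

Local Open Scope classical_set_scope.
Local Open Scope ring_scope.

Definition discrete_harmonic (R : realType) (u : int * int -> R) : Prop :=
  forall n m : int,
    4%:R * u (n, m) = u (n + 1, m) + u (n - 1, m) + u (n, m + 1) + u (n, m - 1).

Definition square (N : nat) : set (int * int) :=
  [set p | `|p.1| <= N%:Z /\ `|p.2| <= N%:Z].

Definition sublevel (R : realType) (u : int * int -> R) : set (int * int) :=
  [set p | `|u p| <= 1].

(* [fset_set] sends infinite sets to [fset0], so this is the number of elements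
   of [S] only when [S] is finite, as [square N] and its subsets are. *)
Definition num_points (S : set (int * int)) : nat := #|` fset_set S|.

Lemma finite_square (N : nat) : finite_set (square N).
Proof.
pose f (p : 'I_N.*2.+1 * 'I_N.*2.+1) : int * int :=
  ((p.1 : nat)%:Z - N%:Z, (p.2 : nat)%:Z - N%:Z).
suff h : forall z : int, `|z| <= N%:Z ->
    exists i : 'I_N.*2.+1, (i : nat)%:Z - N%:Z = z.
  apply: (@sub_finite_set _ _ (f @` setT)); last first.
    exact/finite_image/finite_finset.
  by move=> [x y] [/= /h[i <-] /h[j <-]]; exists (i, j).
move=> z; rewrite ler_norml => /andP[zl zu].
have z0 : 0 <= z + N%:Z by rewrite -lerBlDr sub0r.
have zb : (absz (z + N%:Z)%R < N.*2.+1)%N.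
  by rewrite -ltz_nat gez0_abs// -addn1 PoszD ltzD1 -addnn PoszD lerD2r.
by exists (Ordinal zb); rewrite /= gez0_abs// addrK.
Qed.

(* Main.v *)
(* The harmonicity equation on two neighbouring diagonals determines the next one
   up to an alternating constant, so [h] diagonals above two diagonals where [u]
   is bounded by [B] the function is, up to signs and an error [C^h B], a
   polynomial of degree less than [h]. If it is at most [1] at many points of one
   such diagonal, interpolation bounds it there, and then on all the diagonals in
   between. Hence a bound [B] on a rotated square of radius [r] becomes [C^r B] on
   a square larger by a fixed factor, provided the large values have small density
   at scale [r]. The maximal inequality yields centers around which the density is
   small at all scales; growing squares from them inside squares of radius
   [N / D] around every point gives [|u| <= C^(N / D)] on [Q_N], with [D] as large
   as we like when [eps] is small.

   Such slow growth makes [u] smooth on long scales: the gradient estimate bounds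
   differences of order [2k] on rows and columns, and Lagrange interpolation at
   almost equally spaced points where [|u| <= 1], around the point of evaluation,
   has coefficients subexponential in [k]. This halves the exponential growth rate
   without worsening the constant. Iterating, [u] is bounded, hence constant. *)
Require Import Defs.
From mathcomp Require Import all_boot all_order all_algebra.
From mathcomp Require Import finmap boolp classical_sets functions cardinality reals.
From mathcomp Require Import zify ring lra.

Set Implicit Arguments.
Unset Strict Implicit.
Unset Printing Implicit Defensive.
Import Order.TTheory GRing.Theory Num.Theory.
Local Open Scope ring_scope.

(** * Finite differences and interpolation on the integers *)

Definition fdiff (V : zmodType) (f : int -> V) (x : int) : V := f (x + 1) - f x.

Lemma iter_fdiff_ext (V : zmodType) n (f g : int -> V) :
  f =1 g -> iter n (@fdiff V) f =1 iter n (@fdiff V) g.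
Proof. by move=> fg; elim: n => [|n IH] x //=; rewrite /fdiff !IH. Qed.

Lemma iter_fdiffD (V : zmodType) n (f g : int -> V) x :
  iter n (@fdiff V) (fun y => f y + g y) x =
  iter n (@fdiff V) f x + iter n (@fdiff V) g x.
Proof.
elim: n x => [|n IH] x //=; rewrite /fdiff !IH opprD !addrA.
by congr (_ + _); rewrite -!addrA; congr (_ + _); rewrite addrC.
Qed.

Lemma iter_fdiffN (V : zmodType) n (f : int -> V) x :
  iter n (@fdiff V) (fun y => - f y) x = - iter n (@fdiff V) f x.
Proof. by elim: n x => [|n IH] x //=; rewrite /fdiff !IH opprB opprK addrC. Qed.

Lemma iter_fdiffZ (R : comNzRingType) n (c : R) (f : int -> R) x :
  iter n (@fdiff R) (fun y => c * f y) x = c * iter n (@fdiff R) f x.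
Proof. by elim: n x => [|n IH] x //=; rewrite /fdiff !IH mulrBr. Qed.

Lemma iter_fdiff0 (V : zmodType) n (x : int) :
  iter n (@fdiff V) (fun=> 0) x = 0.
Proof. by elim: n x => [|n IH] x //=; rewrite /fdiff !IH subr0. Qed.

Lemma iter_fdiff_sum (R : comNzRingType) (I : finType) n (F : I -> int -> R) x :
  iter n (@fdiff R) (fun y => \sum_i F i y) x = \sum_i iter n (@fdiff R) (F i) x.
Proof.
elim: n x => [|n IH] x //=; rewrite /fdiff !IH -sumrB.
by apply: eq_bigr => i _.
Qed.

(** Leibniz rule: differences of [y - a] beyond the first vanish, so only two terms survive. *)
Lemma iter_fdiff_linear_factor (R : comNzRingType) n (a : int) (f : int -> R) x :
  iter n.+1 (@fdiff R) (fun y => (y - a)%:~R * f y) x =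
  (x + n.+1%:Z - a)%:~R * iter n.+1 (@fdiff R) f x +
  n.+1%:R * iter n (@fdiff R) f x.
Proof.
elim: n x => [|n IH] x.
  rewrite /= /fdiff !rmorphB !rmorphD /=; ring.
rewrite iterS /fdiff !IH /=.
rewrite (_ : iter n (@fdiff R) f (x+1) = iter n (@fdiff R) f x + fdiff (iter n (@fdiff R) f) x); last first.
  by rewrite /fdiff addrCA subrr addr0.
set g := iter n _ f.
rewrite /fdiff !rmorphB !rmorphD /=; ring.
Qed.

(** The product is a monic polynomial of degree [size s]; its roots are removed one by one through
    the Leibniz rule. *)
Lemma iter_fdiff_prod (R : comNzRingType) n (s : seq int) x : (size s <= n)%N ->
  iter n (@fdiff R) (fun y => \prod_(a <- s) (y - a)%:~R) x =
  (size s == n)%:R * n`!%:R.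
Proof.
elim: s n x => [|a s IH] n x /=.
  move=> _; rewrite (iter_fdiff_ext n (g := fun=> 1)); last by move=> y; rewrite big_nil.
  case: n => [|n] /=; first by rewrite mulr1.
  rewrite mul0r -iterS iterSr (iter_fdiff_ext n (g := fun=> 0)) ?iter_fdiff0//.
  by move=> y; rewrite /fdiff subrr.
case: n => [//|n] sn.
under iter_fdiff_ext do rewrite big_cons.
rewrite (iter_fdiff_linear_factor n a (fun y => \prod_(j <- s) (y - j)%:~R)) !IH//; last by rewrite ltnW.
by rewrite ltn_eqF// eqSS factS natrM mulrCA mul0r add0r mulrCA.
Qed.

Lemma fdiff_le0 (R : realDomainType) (f : int -> R) a b : a < b ->
  0 <= f a -> f b <= 0 -> exists z, [/\ a <= z, z < b & fdiff f z <= 0].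
Proof.
move=> ab fa.
have [n ->] : exists n : nat, b = a + n.+1%:Z.
  by exists `|b - a|%N.-1; lia.
elim: n {b ab} => [|n IH] fb.
  by exists a; split; rewrite ?ltrDl ?lexx // /fdiff; lra.
have [fn|fn] := lerP (f (a + n.+1%:Z)) 0.
  by have [z [az zb fz]] := IH fn; exists z; split=> //; lia.
exists (a + n.+1%:Z); split; [lia|lia|].
by rewrite /fdiff (_ : _ + _ + 1 = a + n.+2%:Z); [lra|lia].
Qed.

(* Rolle's theorem loses exactness on the integers; what survives one
   difference is a weak alternation of signs. *)
Lemma iter_fdiff_alternation (R : realDomainType) n (f : int -> R) (y : nat -> int) :
  (forall i, (i < n)%N -> y i < y i.+1) ->
  (forall i, (i <= n)%N -> 0 <= (-1) ^+ i * f (y i)) ->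
  exists z, [/\ y 0 <= z, z + n%:Z <= y n & 0 <= (-1) ^+ n * iter n (@fdiff R) f z].
Proof.
elim: n f y => [|n IH] f y ylt fy.
  by exists (y 0); split; rewrite ?lexx ?addr0//; exact: fy.
have /choice[zz zzP] : forall i, exists z, (i <= n)%N ->
    [/\ y i <= z, z < y i.+1 & 0 <= (-1) ^+ i * - fdiff f z].
  move=> i; have [ni|ni] := ltnP n i; first by exists 0; lia.
  have h1 := fy i (leqW ni); have h2 := fy i.+1 ni.
  have [z [z1 z2 z3]] : exists z, [/\ y i <= z, z < y i.+1 &
      fdiff (fun x => (-1) ^+ i * f x) z <= 0].
    apply: fdiff_le0 => //; first exact: ylt.
    by move: h2; rewrite exprS mulN1r mulNr oppr_ge0.
  by exists z; move=> _; split => //; move: z3; rewrite /fdiff; lra.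
have [||z [z1 z2 z3]] := IH (fun x => - fdiff f x) zz.
- move=> i ni; have [_ h _] := zzP i (ltnW ni).
  by have [h' _ _] := zzP i.+1 ni; exact: lt_le_trans h h'.
- by move=> i ni; have [_ _] := zzP i ni.
exists z; split.
- by have [h _ _] := zzP 0 isT; exact: le_trans h z1.
- by have [_ h _] := zzP n (leqnn n); lia.
- by move: z3; rewrite iter_fdiffN -iterSr exprS mulN1r mulNr mulrN.
Qed.

(** Subtract from [g] its interpolant and the multiple [c] of the nodal polynomial [om] for which
    the rest [F] vanishes at [x] too. Having one zero more than the order [n = #|I|] of the
    difference, [F] has [n]-th differences of either weak sign, which forces [|c| <= D / n!]. *)
Lemma lagrange_interpolation_le (R : realFieldType) (I : finType) (y : I -> int)
    (g : int -> R) (lo hi x : int) (A D : R) :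
  injective y -> (forall i, lo <= y i <= hi) -> lo <= x <= hi -> 0 <= D ->
  (forall i, `|g (y i)| <= A) ->
  (forall z : int, lo <= z -> z + #|I|%:Z <= hi -> `|iter #|I| (@fdiff R) g z| <= D) ->
  `|g x| <= A * (\sum_i \prod_(j | j != i) (`|x - y j|%:~R / `|y i - y j|%:~R))
            + D / (#|I|)`!%:R * \prod_j `|x - y j|%:~R.
Proof.
move=> yI ylh xlh D0 gA gD.
have fact0 : 0 < (#|I|)`!%:R :> R by rewrite ltr0n fact_gt0.
have coef0 i : 0 <= \prod_(j | j != i) (`|x - y j|%:~R / `|y i - y j|%:~R) :> R.
  by apply: prodr_ge0 => j _; apply: divr_ge0; rewrite ler0z normr_ge0.
have rem0 : 0 <= D / (#|I|)`!%:R * \prod_j `|x - y j|%:~R.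
  apply: mulr_ge0; first exact: divr_ge0 (ltW fact0).
  by apply: prodr_ge0 => j _; rewrite ler0z normr_ge0.
have [/existsP[i0 /eqP xi0]|/existsPn xny] := boolP [exists i, x == y i].
  have A0 : 0 <= A by exact: le_trans (gA i0).
  rewrite xi0 in rem0 coef0 *; apply: le_trans (gA i0) _; rewrite -[leLHS]addr0 lerD//.
  rewrite -[leLHS]mulr1 ler_wpM2l// (bigD1 i0)//= -[leLHS]addr0 lerD//; last exact: sumr_ge0.
  rewrite big1// => j ji0; rewrite divff// intr_eq0 normr_eq0 subr_eq0.
  by apply: contra ji0 => /eqP/yI ->.
pose l i (z : int) : R := \prod_(j | j != i) ((z - y j)%:~R / (y i - y j)%:~R).
pose om (z : int) : R := \prod_j (z - y j)%:~R.
have omx : om x != 0.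
  apply/prodf_neq0 => j _; rewrite intr_eq0 subr_eq0; exact: xny.
have lE i j : l i (y j) = (i == j)%:R.
  rewrite /l; have [<-|ij] := eqVneq i j.
    rewrite big1// => k ki; rewrite divff// intr_eq0 subr_eq0.
    by apply: contra ki => /eqP/yI ->.
  by rewrite (bigD1 j) 1?eq_sym//= subrr mul0r mul0r.
pose c := (g x - \sum_i g (y i) * l i x) / om x.
pose F z := g z + (- (\sum_i g (y i) * l i z) + - (c * om z)).
have Fy j : F (y j) = 0.
  rewrite /F (bigD1 j)//= lE eqxx mulr1 big1 ?addr0; last first.
    by move=> i ij; rewrite lE (negbTE ij) mulr0.
  by rewrite /om (bigD1 j)//= subrr mul0r mulr0 oppr0 addr0 subrr.
have Fx : F x = 0.
  by rewrite /F /c divfK//; lra.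
have dl i z : iter #|I| (@fdiff R) (l i) z = 0.
  pose s := [seq y j | j <- enum I & j != i].
  rewrite (iter_fdiff_ext _ (g := fun z => (\prod_(j | j != i) ((y i - y j)%:~R : R)^-1) *
     \prod_(a <- s) (z - a)%:~R)); last first.
    move=> z'; rewrite /s big_map big_filter big_enum_cond/= mulrC.
    by rewrite /l big_split.
  have ss : (size s < #|I|)%N.
    rewrite /s size_map size_filter cardE -(count_predC (fun j => j != i)).
    rewrite -[ltnLHS]addn0 ltn_add2l -has_count; apply/hasP.
    by exists i; rewrite ?mem_enum//= negbK eqxx.
  by rewrite iter_fdiffZ iter_fdiff_prod ?(ltnW ss)// ltn_eqF// mul0r mulr0.
have dom z : iter #|I| (@fdiff R) om z = (#|I|)`!%:R.
  rewrite (iter_fdiff_ext _ (g := fun z => \prod_(a <- codom y) (z - a)%:~R)).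
    by rewrite iter_fdiff_prod size_codom ?eqxx ?mul1r.
  by move=> z'; rewrite /om codomE big_map big_enum.
have dF z : iter #|I| (@fdiff R) F z = iter #|I| (@fdiff R) g z - c * (#|I|)`!%:R.
  rewrite iter_fdiffD iter_fdiffD !iter_fdiffN iter_fdiffZ dom iter_fdiff_sum.
  by rewrite big1 ?oppr0 ?add0r// => i _; rewrite iter_fdiffZ dl mulr0.
pose s := sort <=%O (x :: codom y).
have ssz : size s = #|I|.+1 by rewrite size_sort /= size_codom.
have su : sorted <%O s.
  rewrite sort_lt_sorted /= map_inj_uniq ?enum_uniq// andbT.
  by apply/negP => /codomP[i xi]; have := xny i; rewrite xi eqxx.
have slh z : z \in s -> lo <= z <= hi.
  by rewrite mem_sort inE => /orP[/eqP->//|/codomP[i ->]].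
have sF z : z \in s -> F z = 0.
  by rewrite mem_sort inE => /orP[/eqP->//|/codomP[i ->]].
(* Zeros fit both alternating sign patterns, so the weak sign can be prescribed; the parity of
   [#|I|] in the prefactor cancels the sign produced by the alternation. *)
have alt (e : bool) : exists z, [/\ lo <= z, z + #|I|%:Z <= hi &
    0 <= (-1) ^+ e * iter #|I| (@fdiff R) F z].
  have [||z [z1 z2 z3]] := @iter_fdiff_alternation R #|I| (fun z => (-1) ^+ (e (+) odd #|I|) * F z) (nth 0 s).
  - move=> i iI; apply: (sorted_ltn_nth lt_trans) => //; rewrite inE ssz; lia.
  - by move=> i iI; rewrite sF ?mulr0// mem_nth ?ssz.
  have /slh/andP[lo0 _] : nth 0 s 0 \in s by rewrite mem_nth ?ssz.
  have /slh/andP[_ hi0] : nth 0 s #|I| \in s by rewrite mem_nth ?ssz.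
  exists z; split; [exact: le_trans z1|exact: le_trans z2 _|].
  move: z3; rewrite iter_fdiffZ mulrA -signr_odd -signr_addb.
  by rewrite [e (+) _]addbC addbA addbb addFb.
have cD : `|c| <= D / (#|I|)`!%:R.
  rewrite ler_pdivlMr// -[X in _ * X]ger0_norm ?(ltW fact0)// -normrM ler_norml.
  have [z [z1 z2]] := alt false; have := gD _ z1 z2.
  have [z' [z1' z2']] := alt true; have := gD _ z1' z2'.
  by rewrite !dF !ler_norml expr1 expr0; lra.
have -> : g x = \sum_i g (y i) * l i x + c * om x.
  by move: Fx; rewrite /F; lra.
apply: le_trans (ler_normD _ _) _; apply: lerD.
  rewrite mulr_sumr; apply: le_trans (ler_norm_sum _ _ _) _; apply: ler_sum => i _.
  rewrite normrM; apply: ler_pM => //.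
  rewrite /l normr_prod; apply: ler_prod => j _.
  by rewrite normr_ge0 normrM normfV -!intr_norm lexx.
rewrite normrM; apply: ler_pM => //.
by rewrite /om normr_prod; apply: ler_prod => j _; rewrite normr_ge0 -intr_norm lexx.
Qed.

(** * Factorial estimates, choice of nodes and extrapolation *)

Lemma leq_bin_exp2 n m : ('C(n, m) <= 2 ^ n)%N.
Proof.
elim: n m => [|n IH] [|m]; rewrite ?bin0 ?bin0n ?expn_gt0//.
by rewrite binS expnS mul2n -addnn leq_add.
Qed.

Lemma leq_exp_ffact n m : ((n - m) ^ m <= n ^_ m)%N.
Proof.
elim: m n => [|m IH] [|n] //; first by rewrite sub0n exp0n.
by rewrite ffactSS expnS subSS leq_mul// (leq_trans (leq_subr _ _)).
Qed.

(** Compare [n ^ n] with the falling factorial [n.*2 ^_ n], which is [n!] times a binomial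
    coefficient of at most [4 ^ n]. *)
Lemma leq_expnn_fact n : (n ^ n <= 4 ^ n * n`!)%N.
Proof.
have := leq_exp_ffact n.*2 n; rewrite -addnn addnK => /leq_trans; apply.
rewrite -bin_ffact leq_mul2r (_ : 4 = 2 ^ 2)%N// -expnM mulnC muln2 -addnn.
by rewrite leq_bin_exp2 orbT.
Qed.

(** These are the denominators of Lagrange coefficients at consecutive integers; as subtraction is
    truncated, [(i - j) + (j - i)] is the distance from [i] to [j]. *)
Lemma prod_dist_ord n i : (i <= n)%N ->
  (\prod_(j < n.+1 | j != i :> nat) ((i - j) + (j - i)) = i`! * (n - i)`!)%N.
Proof.
elim: n => [|n IH] in i *.
  by rewrite leqn0 => /eqP->; rewrite big_mkcond big_ord_recr big_ord0.
rewrite leq_eqVlt => /predU1P[->|iltn].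
  rewrite subnn fact0 muln1 big_mkcond big_ord_recr /= eqxx muln1.
  rewrite fact_prod big_add1 big_mkord (reindex_inj rev_ord_inj)/=.
  apply: eq_bigr => j _. by case: eqP => [h|h] /=; have := ltn_ord j; lia.
rewrite big_mkcond big_ord_recr /= -big_mkcond /= IH//.
rewrite (_ : (n.+1 != i) = true); last by rewrite eq_sym ltn_eqF.
have ilen : (i <= n)%N by []. rewrite -mulnA; congr muln; rewrite (subSn ilen) factS
  mulnC; congr muln; move: iltn; lia.
Qed.

Lemma count_select (G : pred nat) W k : (k < \sum_(i < W) G i)%N ->
  exists t, [/\ (t < W)%N, G t & (\sum_(i < t) G i = k)%N].
Proof.
elim: W => [|W IH]; first by rewrite big_ord0.
rewrite big_ord_recr /=; have [/IH[t [tW Gt kt]] _|] := ltnP k (\sum_(i < W) G i).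
  by exists t; rewrite ltnS ltnW.
case GW : (G W) => h; last by rewrite addn0 ltnNge h.
by move=> h'; exists W; split => //; move: h h'; rewrite /=; lia.
Qed.

(** A running count grows by at most one per step, so selected points whose ranks differ by [k] lie
    at least [k] apart. *)
Lemma count_lipschitz (G : pred nat) s t :
  (\sum_(i < t) G i - \sum_(i < s) G i <= t - s)%N.
Proof.
have step a k : (\sum_(i < a) G i <= \sum_(i < a + k) G i <= \sum_(i < a) G i + k)%N.
  elim: k => [|k IH]; first by rewrite !addn0 !leqnn.
  rewrite !addnS big_ord_recr /=; move: (nat_of_bool (G (a + k)%N)) (leq_b1 (G (a + k)%N)) IH.
  by move: (\sum_(i < a) _)%N (\sum_(i < a + k) _)%N => x y b; lia.
have [st|/ltnW ts] := leqP s t.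
  by have := step s (t - s)%N; rewrite (subnKC st) => /andP[_]; rewrite leq_subLR.
have := step t (s - t)%N; rewrite (subnKC ts) => /andP[+ _].
by rewrite -subn_eq0 => /eqP->.
Qed.

Lemma count_predC_ord (G : pred nat) t :
  (\sum_(i < t) G i + \sum_(i < t) ~~ G i = t)%N.
Proof.
rewrite -big_split /= (eq_bigr (fun=> 1%N)) ?sum1_card ?card_ord//.
by move=> i _; case: (G i).
Qed.

(** Take the first [d] good points as nodes. They are at least as far apart as [0, ..., d - 1], and
    at most [W] away from [x], so the Lagrange coefficients sum to at most [(2 * W) ^ d / d!]; the
    bound [d ^ d <= 4 ^ d * d!] turns this into a power of [8 * c]. *)
Lemma bounded_extrapolation (R : realFieldType) (g : int -> R) (p : int) (W d c : nat) (A D : R) :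
  (0 < d)%N -> (W <= c * d)%N -> 0 <= D ->
  (d <= \sum_(j < W) (`|g (p + (j : nat)%:Z)| <= A)%R)%N ->
  (forall z : int, p <= z -> z + d%:Z < p + W%:Z -> `|iter d (@fdiff R) g z| <= D) ->
  forall x : int, p <= x -> x < p + W%:Z -> `|g x| <= (8 * c)%:R ^+ d * (A + D).
Proof.
move=> d0 Wcd D0 dG gD x px xW.
set G : pred nat := fun j => `|g (p + j%:Z)| <= A.
have /choice[t tP] : forall i : 'I_d, exists t, [/\ (t < W)%N, G t & (\sum_(j < t) G j = i)%N].
  by move=> i; apply: count_select; apply: leq_trans dG.
have dW : (d <= W)%N.
  apply: leq_trans dG _; rewrite -[leqRHS](count_predC_ord G W); exact: leq_addr.
have A0 : 0 <= A.
  by have [_ h _] := tP (Ordinal d0); exact: le_trans (normr_ge0 _) h.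
pose y (i : 'I_d) : int := p + (t i)%:Z.
have ydist (i j : 'I_d) : ((i - j) + (j - i))%N%:Z <= `|y i - y j|.
  have [_ _ ti] := tP i; have [_ _ tj] := tP j.
  have := count_lipschitz G (t i) (t j); have := count_lipschitz G (t j) (t i).
  rewrite ti tj /y; lia.
have yI : injective y.
  move=> i j yij; apply/val_inj => /=; have := ydist i j.
  by rewrite yij subrr normr0; lia.
have ylt i : p <= y i <= p + W%:Z - 1.
  by have [] := tP i; rewrite /y; lia.
have := @lagrange_interpolation_le R 'I_d y g p (p + W%:Z - 1) x A D yI ylt _ D0.
rewrite card_ord => /(_ _ _ _)/le_trans; apply.
- by lia.
- by move=> i; have [] := tP i.
- by move=> z pz zW; apply: gD; lia.
have f0 n : 0 < n`!%:R :> R by rewrite ltr0n fact_gt0.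
have xd j : `|x - y j|%:~R <= W%:R :> R.
  have := ylt j => h; rewrite -[leRHS]mulrz_nat ler_int; lia.
have num : (2 * W)%:R ^+ d / d`!%:R <= (8 * c)%:R ^+ d :> R.
  rewrite ler_pdivrMr// -!natrX -natrM ler_nat.
  apply: (@leq_trans ((2 * (c * d)) ^ d)); first by rewrite leq_exp2r// leq_mul2l Wcd orbT.
  rewrite mulnA expnMn (_ : 8 * c = (2 * c) * 4)%N; last lia.
  by rewrite [X in (_ <= X * _)%N]expnMn -mulnA leq_mul2l leq_expnn_fact orbT.
rewrite mulrDr [X in _ <= X + _]mulrC; apply: lerD; last first.
  rewrite [leRHS]mulrC -mulrA ler_wpM2l//; apply: le_trans num; rewrite mulrC ler_wpM2r ?invr_ge0 ?ler0n//.
  apply: (@le_trans _ _ (\prod_(j < d) W%:R)).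
    by apply: ler_prod => j _; rewrite ler0z normr_ge0 xd.
  by rewrite prodr_const card_ord lerXn2r ?nnegrE ?ler0n// ler_nat; lia.
rewrite ler_wpM2l//; apply: le_trans num.
case: d d0 Wcd dG gD t tP dW y ydist yI ylt xd => // n _ _ _ _ t _ nW y ydist _ _ xd.
apply: (@le_trans _ _ (\sum_(i < n.+1) W%:R ^+ n / (i`! * (n - i)`!)%:R)).
  apply: ler_sum => i _; have i_n : (i <= n)%N by rewrite -ltnS.
  rewrite -prod_dist_ord// prodf_div natr_prod.
  apply: ler_pM.
  - by apply: prodr_ge0 => j _; rewrite ler0z normr_ge0.
  - by rewrite invr_ge0; apply: prodr_ge0 => j _; rewrite ler0z normr_ge0.
  - apply: (@le_trans _ _ (\prod_(j < n.+1 | j != i) W%:R)).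
      by apply: ler_prod => j _; rewrite ler0z normr_ge0 xd.
    by rewrite prodr_const cardC1 card_ord.
  rewrite lef_pV2 ?posrE.
  - apply: ler_prod => j ji; rewrite ler0n -[leLHS]mulrz_nat ler_int natz; exact: ydist.
  - apply: prodr_gt0 => j ji; rewrite ltr0z normr_gt0 subr_eq0.
    apply: contra ji => /eqP yij; apply/eqP/val_inj => /=.
    by have := ydist i j; rewrite yij subrr normr0; lia.
  - by apply: prodr_gt0 => j ji; rewrite ltr0n addn_gt0 !subn_gt0 -neq_ltn.
have -> : \sum_(i < n.+1) W%:R ^+ n / (i`! * (n - i)`!)%:R = (2 * W)%:R ^+ n / n`!%:R :> R.
  transitivity (\sum_(i < n.+1) (W%:R ^+ n / n`!%:R * 'C(n, i)%:R : R)).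
    apply: eq_bigr => i _; have i_n : (i <= n)%N by rewrite -ltnS.
    rewrite -(bin_fact i_n) [in RHS]natrM; field.
    by rewrite !gt_eqF ?f0 ?ltr0n ?bin_gt0.
  rewrite -mulr_sumr -natr_sum -[X in _ * X%:R](_ : 2 ^ n = _)%N.
    by rewrite natrM exprMn natrX; field; rewrite gt_eqF.
  by rewrite (expnDn 1 1); apply: eq_bigr => i _; rewrite !exp1n !muln1.
(* Passing from [n] to [n.+1] in the bound multiplies it by [2 * W / n.+1], which is at least one
   because the window holds all the nodes. *)
have : n.+1%:R <= (2 * W)%:R :> R by rewrite ler_nat; lia.
move: (2 * W)%:R => a na; have a0 : 0 <= a by exact: le_trans na.
rewrite factS natrM exprSr invfM mulrA ler_wpM2r ?invr_ge0 ?ler0n//.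
rewrite -[leLHS]mulr1 -mulrA ler_wpM2l ?exprn_ge0//.
by rewrite ler_pdivlMr ?ltr0n// mul1r.
Qed.

(** Log-convexity of the factorial: each step replaces the factor [k - j] by the larger
    [k + j + 1]. *)
Lemma leq_fact_sqr k j : (j <= k)%N -> (k`! ^ 2 <= (k - j)`! * (k + j)`!)%N.
Proof.
elim: j => [|j IH] jk; first by rewrite subn0 addn0 -mulnn.
apply: leq_trans (IH (ltnW jk)) _.
rewrite addnS factS -(subnSK jk) factS mulnAC mulnC leq_mul2l; apply/orP; right.
by rewrite leq_mul2r; apply/orP; right; lia.
Qed.

Lemma prod_shift_fact a k : (\prod_(j < k) (j + a.+1) * a`! = (a + k)`!)%N.
Proof.
elim: k => [|k IH]; first by rewrite big_ord0 mul1n addn0.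
by rewrite big_ord_recr /= [in RHS]addnS factS -IH mulnAC mulnC; congr muln; lia.
Qed.

Lemma prod_shift_bin m k : (\prod_(j < k) (j + m.+1) = 'C(k + m, k) * k`!)%N.
Proof.
apply/eqP; rewrite -(eqn_pmul2r (fact_gt0 m)) prod_shift_fact addnC.
by rewrite -(bin_fact (leq_addr m k)) addKn mulnA.
Qed.

Lemma prod_bool_pair (R : comNzRingType) k (F : bool * 'I_k -> R) b i :
  \prod_(p | p != (b, i)) F p =
  (\prod_(j | j != i) F (b, j)) * \prod_j F (~~ b, j).
Proof.
rewrite big_mkcond (eq_bigr (fun p => if (p.1, p.2) != (b, i) then F (p.1, p.2) else 1)).
  rewrite -(pair_bigA _ (fun c j => if (c, j) != (b, i) then F (c, j) else 1)) /= big_bool.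
  case: b => /=; rewrite [in RHS]big_mkcond /=; last rewrite mulrC;
    by congr (_ * _); apply: eq_bigr => j _; rewrite xpair_eqE.
by case.
Qed.

(* Taking every [S]-th good point on either side of [x] makes the nodes almost
   equally spaced, and an equally spaced Lagrange formula is stable at the
   centre of its nodes: every coefficient is at most ['C(k + m, k) ^ 2], which
   is subexponential in [k] as [m / k] tends to [0]. *)
Lemma centered_interpolation (R : realFieldType) (g : int -> R) (x : int)
    (W k S m : nat) (A D : R) :
  (0 < S)%N -> 0 <= D -> 0 <= A ->
  (forall e : bool, S * k <= \sum_(j < W) (`|g (x + (-1) ^+ e * (j.+1)%:Z)| <= A)%R)%N ->
  (forall e : bool, \sum_(j < W) ~~ (`|g (x + (-1) ^+ e * (j.+1)%:Z)| <= A)%R <= m * S)%N ->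
  (forall z : int, x - W%:Z <= z -> z + (k.*2)%:Z <= x + W%:Z ->
     `|iter k.*2 (@fdiff R) g z| <= D) ->
  `|g x| <= 'C(k + m, k)%:R ^+ 2 * ((k.*2)%:R * A + S%:R ^+ k.*2 * D).
Proof.
move=> S0 D0 A0 good bad gD.
pose G (e : bool) : pred nat := fun j => `|g (x + (-1) ^+ e * (j.+1)%:Z)| <= A.
(* Ranks start at zero: node [i] on a side is the good point number [S * i.+1] counted away from
   [x]. *)
have /choice[t tP] : forall p : bool * 'I_k, exists t,
    [/\ (t < W)%N, G p.1 t & (\sum_(j < t) G p.1 j = S * p.2.+1 - 1)%N].
  move=> [e i]; apply: count_select; apply: leq_trans (good e).
  by have := ltn_ord i; rewrite /=; nia.
pose y (p : bool * 'I_k) : int := x + (-1) ^+ p.1 * (t p).+1%:Z.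
have xdist (p : bool * 'I_k) : `|x - y p| = (t p).+1%:Z.
  by rewrite /y; case: (p.1); rewrite ?expr1 ?expr0; lia.
(* Node [i] lies at distance between [S * i.+1] and [S * (i + m.+1)] from [x], since at most [m * S]
   bad points precede it. *)
have tge (p : bool * 'I_k) : (S * p.2.+1 <= (t p).+1)%N.
  have [_ _] := tP p; have := count_predC_ord (G p.1) (t p).
  set b := (\sum_(i < t p) ~~ _)%N; set a := (\sum_(i < t p) _)%N; nia.
have tle (p : bool * 'I_k) : ((t p).+1 <= S * (p.2 + m.+1))%N.
  have [tW _] := tP p; have := count_predC_ord (G p.1) (t p).
  have : (\sum_(j < W) ~~ G p.1 j <= m * S)%N := bad p.1.
  rewrite -[in X in X -> _](subnKC (ltnW tW)) big_split_ord /=.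
  set c := (\sum_(i < W - _) _)%N; set b := (\sum_(i < t p) ~~ _)%N; set a := (\sum_(i < t p) _)%N.
  have : (0 < S * p.2.+1)%N by rewrite muln_gt0 S0.
  by nia.
have same (e : bool) (i j : 'I_k) : (S * ((i - j) + (j - i)))%N%:Z <= `|y (e, i) - y (e, j)|.
  have [_ _ ti] := tP (e, i); have [_ _ tj] := tP (e, j).
  have := count_lipschitz (G e) (t (e, i)) (t (e, j)).
  have := count_lipschitz (G e) (t (e, j)) (t (e, i)).
  rewrite ti tj /y /= => h1 h2.
  have : (S * ((i - j) + (j - i)) <= (t (e, j) - t (e, i)) + (t (e, i) - t (e, j)))%N.
    have [ij|ij] := leqP i j; move: h1 h2; nia.
  by case: e {h1 h2 ti tj}; rewrite ?expr1 ?expr0; lia.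
have opp (e : bool) (i j : 'I_k) : (S * (j + i.+2))%N%:Z <= `|y (e, i) - y (~~ e, j)|.
  have := tge (e, i); have := tge (~~ e, j); rewrite /y /=.
  by case: e => /=; rewrite ?expr1 ?expr0; nia.
have yI : injective y.
  move=> [e i] [e' j] yy; have [ee|ee] := eqVneq e e'.
    rewrite ee in yy *; congr (_, _); apply: ord_inj.
    by have := same e' i j; rewrite yy subrr normr0; nia.
  have {ee} ee : e' = ~~ e by case: e e' ee {yy} => -[].
  by have := opp e i j; rewrite -ee -yy subrr normr0; nia.
have ylt (p : bool * 'I_k) : x - W%:Z <= y p <= x + W%:Z.
  have [tW _ _] := tP p; have := xdist p; lia.
have cI : #|{: bool * 'I_k}| = k.*2 by rewrite card_prod card_bool card_ord mul2n.
have := @lagrange_interpolation_le R _ y g (x - W%:Z) (x + W%:Z) x A D yI ylt _ D0.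
rewrite cI => /(_ _ _ gD)/le_trans; apply.
- by lia.
- by move=> p; have [] := tP p.
have num (p : bool * 'I_k) : `|x - y p|%:~R <= (S * (p.2 + m.+1))%:R :> R.
  by rewrite -[leRHS]mulrz_nat ler_int xdist natz lez_nat tle.
have f0 n : 0 < n`!%:R :> R by rewrite ltr0n fact_gt0.
set b := 'C(k + m, k).
rewrite mulrDr; apply: lerD.
  rewrite mulrA mulrC ler_wpM2r//.
  rewrite -cI -[X in _ * X](_ : \sum_(p : bool * 'I_k) 1 = _); last first.
    by rewrite sumr_const.
  rewrite mulr_sumr; apply: ler_sum => -[e i] _; rewrite mulr1 prod_bool_pair.
  have ik := ltn_ord i; have S0R : S%:R != 0 :> R by rewrite pnatr_eq0 -lt0n.
  have term (p q : bool * 'I_k) (dd : nat) : (0 < dd)%N -> (S * dd)%N%:Z <= `|y p - y q| ->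
      0 <= (`|x - y q|%:~R / `|y p - y q|%:~R : R) <= (q.2 + m.+1)%:R / dd%:R.
    move=> dd0 h; rewrite divr_ge0 ?ler0z//=.
    have -> : (q.2 + m.+1)%:R / dd%:R = (S * (q.2 + m.+1))%:R / (S * dd)%:R :> R.
      by rewrite !natrM -mulf_div divff// mul1r.
    have dd1 : 0 < (S * dd)%:R :> R by rewrite ltr0n muln_gt0 S0.
    have dd2 : (S * dd)%:R <= `|y p - y q|%:~R :> R by rewrite -[leLHS]mulrz_nat ler_int natz.
    apply: ler_pM; rewrite ?ler0z ?invr_ge0 ?ler0z//.
    by rewrite lef_pV2 ?posrE// (lt_le_trans dd1).
  (* The scale [S] has cancelled; the first product belongs to the nodes on the side of the node
     [(e, i)], the second to the opposite side. *)
  apply: (@le_trans _ _ ((\prod_(j < k | j != i) ((j + m.+1)%:R / ((i - j) + (j - i))%:R)) *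
                         (\prod_(j < k) ((j + m.+1)%:R / (j + i.+2)%:R)))).
    apply: ler_pM.
    - by apply: prodr_ge0 => j _; rewrite divr_ge0 ?ler0z.
    - by apply: prodr_ge0 => j _; rewrite divr_ge0 ?ler0z.
    - apply: ler_prod => j ji; apply: term; last exact: same.
      by rewrite addn_gt0 !subn_gt0 -neq_ltn.
    - by apply: ler_prod => j _; apply: term; [lia|exact: opp].
  rewrite !prodf_div -!natr_prod mulf_div -!natrM.
  rewrite {}/b; case: k i ik {term num good bad gD t tP y xdist tge tle same opp yI ylt
    cI} => [[]//|k] i ik; set b := 'C(k.+1 + m, k.+1).
  rewrite (prod_dist_ord (n := k)) ?(prod_shift_bin m)//.
  have den : (\prod_(j < k.+1) (j + i.+2) * i.+1`! = (i.+1 + k.+1)`!)%N.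
    exact: prod_shift_fact.
  have numi : ((\prod_(j < k.+1 | j != i) (j + m.+1)) * i.+1 <= b * k.+1`!)%N.
    rewrite -prod_shift_bin [leqRHS](bigD1 i)//= mulnC leq_mul2r; apply/orP; right; lia.
  (* Together the two sides give the denominator [(k - i)! * (k + i + 2)!], which is at least the
     square of [k.+1!] left in the numerator beside [b ^ 2]. *)
  have lf := @leq_fact_sqr k.+1 i.+1 ik.
  set X := (\prod_(j < k.+1 | _) _)%N in numi *; set Y := (\prod_(j < k.+1) _)%N in den *.
  have Y0 : (0 < Y)%N by rewrite /Y; apply: prodn_gt0 => j; lia.
  rewrite ler_pdivrMr ?ltr0n ?muln_gt0 ?fact_gt0// -natrX -natrM ler_nat.
  rewrite -(leq_pmul2r (fact_gt0 k.+1)) -(leq_pmul2r (ltn0Sn i)).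
  move: den lf numi; rewrite subSS (factS i) addnC => <- lf numi.
  have : (X * i.+1 * (b * (k.+1)`!) * (k.+1)`! <= b * k.+1`! * (b * (k.+1)`!) * k.+1`!)%N.
    by rewrite !leq_mul2r numi !orbT.
  by move: lf; move: (k.+1`!) (i`!) ((k - i)`!) => u v w; nia.
rewrite [in X in _ <= X]mulrA [leRHS]mulrC -mulrA ler_wpM2l//.
rewrite mulrC ler_pdivrMr//.
apply: (@le_trans _ _ ((S ^ k.*2 * (b * k`!) ^ 2)%N%:R)).
  rewrite (eq_bigr (fun p : bool * 'I_k => `|x - y (p.1, p.2)|%:~R)); last by case.
  rewrite -(pair_bigA _ (fun e i => `|x - y (e, i)|%:~R)) /= big_bool.
  have side e : 0 <= (\prod_(i < k) `|x - y (e, i)|%:~R : R) <= (S ^ k * (b * k`!))%N%:R.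
    rewrite prodr_ge0 ?ler0z//= -prod_shift_bin.
    apply: (@le_trans _ _ (\prod_(i < k) (S * (i + m.+1))%:R)).
      by apply: ler_prod => i _; rewrite ler0z normr_ge0 /= num.
    by rewrite -natr_prod ler_nat big_split /= prod_nat_const card_ord.
  rewrite -addnn expnD -mulnn mulnACA natrM.
  by apply: ler_pM; case/andP: (side true); case/andP: (side false).
rewrite -!natrX -!natrM ler_nat expnMn.
have := @leq_fact_sqr k k (leqnn k); rewrite subnn mul1n addnn.
by move=> h; rewrite mulnCA -mulnA !leq_mul2l h !orbT.
Qed.

(** * Diagonals of a harmonic function *)

(** Harmonicity links three consecutive diagonals through this operator, which up to alternating
    signs is a difference operator of step two. *)
Definition tsum (V : zmodType) (f : int -> V) (t : int) : V := f (t + 1) + f (t - 1).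

Lemma iter_tsum_ext (V : zmodType) n (f g : int -> V) :
  f =1 g -> iter n (@tsum V) f =1 iter n (@tsum V) g.
Proof. by move=> fg; elim: n => [|n IH] t //=; rewrite /tsum !IH. Qed.

Lemma iter_tsum_lin (R : comNzRingType) n (c : R) (f g : int -> R) t :
  iter n (@tsum R) (fun t => c * f t - g t) t =
  c * iter n (@tsum R) f t - iter n (@tsum R) g t.
Proof. by elim: n t => [|n IH] t //=; rewrite /tsum !IH; ring. Qed.

Lemma iter_tsum_le (R : realDomainType) n (f : int -> R) (a b : int) (C : R) :
  (forall t, a <= t -> t <= b -> `|f t| <= C) ->
  forall t, a + n%:Z <= t -> t + n%:Z <= b -> `|iter n (@tsum R) f t| <= 2 ^+ n * C.
Proof.
move=> fC; elim: n => [|n IH] t at_ tb.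
  by rewrite expr0 mul1r fC//; lia.
rewrite /= /tsum; apply: le_trans (ler_normD _ _) _.
by rewrite exprS -mulrA mulr_natl mulr2n lerD// IH//; lia.
Qed.

(** The alternating sign turns sums of values two apart into differences, so bounds on iterates of
    [tsum] become bounds on finite differences along one parity class. *)
Lemma iter_fdiff_alternate (R : comNzRingType) n (f : int -> R) (c j : int) :
  iter n (@fdiff R) (fun j => (-1) ^+ `|j|%N * f (c + 2 * j)) j =
  (-1) ^+ n * (-1) ^+ `|j|%N * iter n (@tsum R) f (c + 2 * j + n%:Z).
Proof.
have sgS (i : int) : (-1) ^+ `|(i + 1)%R|%N = - (-1) ^+ `|i|%N :> R.
  have [i0|i0] := lerP 0 i.
    by rewrite (_ : `|(i + 1)%R|%N = `|i|%N.+1) ?exprS ?mulN1r//; lia.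
  by rewrite (_ : `|i|%N = `|(i + 1)%R|%N.+1) ?exprS ?mulN1r ?opprK//; lia.
elim: n j => [|n IH] j /=; first by rewrite mul1r addr0.
rewrite /fdiff !IH sgS /tsum exprS.
rewrite (_ : c + 2 * (j + 1) + n%:Z = c + 2 * j + n.+1%:Z + 1); last lia.
rewrite (_ : c + 2 * j + n.+1%:Z - 1 = c + 2 * j + n%:Z); last lia.
ring.
Qed.

Definition row_rec (R : nzRingType) (w : nat -> int -> R) :=
  forall s t, 4%:R * w s.+1 t = tsum (w s.+2) t + tsum (w s) t.

(** Applying [tsum] once per row makes the recurrence explicit without inverting [tsum]; the base
    [5] works because [4 * 5 + 2 ^ 2 <= 5 ^ 2]. *)
Lemma iter_tsum_row_le (R : realDomainType) (w : nat -> int -> R) (a b : int) (B : R) :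
  row_rec w ->
  (forall t, a <= t -> t <= b -> `|w 0%N t| <= B /\ `|w 1%N t| <= B) ->
  forall s t, a + s%:Z <= t -> t + s%:Z <= b ->
    `|iter s (@tsum R) (w s) t| <= 5 ^+ s * B.
Proof.
move=> wr wB s.
suff : (forall t, a + s%:Z <= t -> t + s%:Z <= b ->
         `|iter s (@tsum R) (w s) t| <= 5 ^+ s * B) /\
       (forall t, a + s.+1%:Z <= t -> t + s.+1%:Z <= b ->
         `|iter s.+1 (@tsum R) (w s.+1) t| <= 5 ^+ s.+1 * B) by case.
elim: s => [|s [IH1 IH2]].
  split=> t at_ tb; first by rewrite expr0 mul1r; have [||//] := wB t; lia.
  rewrite expr1 /= /tsum; apply: le_trans (ler_normD _ _) _.
  have [||_ h1] := wB (t + 1); [lia|lia|].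
  have [||_ h2] := wB (t - 1); [lia|lia|].
  by have := normr_ge0 (w 1%N (t + 1)); lra.
split=> // t at_ tb; rewrite iterSr.
rewrite (iter_tsum_ext _ (g := fun t => 4%:R * w s.+1 t - tsum (w s) t)); last first.
  by move=> t'; rewrite wr; ring.
rewrite iter_tsum_lin -iterSr; apply: le_trans (ler_normB _ _) _.
have B0 : 0 <= 5 ^+ s * B by apply: le_trans (IH1 t _ _); [exact: normr_ge0|lia|lia].
have h1 : `|4%:R * iter s.+1 (@tsum R) (w s.+1) t| <= 4%:R * (5 ^+ s.+1 * B).
  by rewrite normrM ger0_norm// ler_wpM2l// IH2//; lia.
have h2 : `|iter s.+2 (@tsum R) (w s) t| <= 2 ^+ 2 * (5 ^+ s * B).
  apply: (@iter_tsum_le _ 2 (iter s (@tsum R) (w s)) (a + s%:Z) (b - s%:Z)); [|lia|lia].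
  by move=> t' h h'; apply: IH1; lia.
by move: h1 h2; rewrite !exprS; lra.
Qed.

(* Repeatedly averaging over the two neighbouring rows is a random walk on the
   rows, absorbed at [0] and [H]; after [n] steps what has not been absorbed is
   controlled by the hypothesis on the [n]-th iterates. *)
Lemma row_between_le (R : realFieldType) n H (w : nat -> int -> R) (a b : int) (A : R) :
  row_rec w ->
  (forall t, a <= t -> t <= b -> `|w 0%N t| <= A /\ `|w H t| <= A) ->
  (forall s t, (s <= H)%N -> a + n%:Z <= t -> t + n%:Z <= b ->
    `|iter n (@tsum R) (w s) t| <= 2 ^+ n * A) ->
  forall s t, (s <= H)%N -> a + n%:Z <= t -> t + n%:Z <= b -> `|w s t| <= A.
Proof.
elim: n w a b A => [|n IH] w a b A wr wA wn s t sH at_ tb.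
  by have := wn s t sH at_ tb; rewrite mul1r.
have tA f : (forall t, a <= t -> t <= b -> `|f t| <= A) ->
    forall t, a + 1 <= t -> t <= b - 1 -> `|tsum f t| <= 2 * A.
  move=> fA t' h h'; rewrite mulr_natl mulr2n; apply: le_trans (ler_normD _ _) _.
  by rewrite lerD// fA//; lia.
(* The rows [tsum (w s)] satisfy the same recurrence with bound [2 * A]; the bound [A] comes back
   because [4 * w s.+1] is a sum of two such terms. *)
have IHw := IH (fun s => tsum (w s)) (a + 1) (b - 1) (2 * A).
have {}IHw : forall s t, (s <= H)%N -> a + n.+1%:Z <= t -> t + n.+1%:Z <= b ->
    `|tsum (w s) t| <= 2 * A.
  move=> s' t' h1 h2 h3; apply: IHw => //; [| | |lia|lia].
  - move=> i x; have := wr i (x + 1); have := wr i (x - 1).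
    by rewrite /tsum => e1 e2; rewrite mulrDr e1 e2; ring.
  - by move=> x hx hx'; split; apply: tA => // y hy hy'; have [] := wA y hy hy'.
  - move=> i x iH hx hx'; rewrite -iterSr mulrA -exprSr; apply: wn => //; lia.
case: s sH => [|s] sH; first by have [||//] := wA t; lia.
move: sH; rewrite leq_eqVlt => /predU1P[sH|sH].
  by rewrite sH; have [||//] := wA t; lia.
have h1 := IHw s.+2 t sH at_ tb.
have h2 := IHw s t (ltnW (ltnW sH)) at_ tb.
have := ler_normD (tsum (w s.+2) t) (tsum (w s) t); rewrite -wr normrM ger0_norm//; lra.
Qed.

Lemma sum_class_le (F : nat -> nat) e n L : (e + n.*2 <= L)%N ->
  (\sum_(j < n.+1) F (e + j.*2) <= \sum_(j < L.+1) F j)%N.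
Proof.
move=> enL; rewrite -(subnKC enL) -addSn big_split_ord /=; apply: leq_trans (leq_addr _ _).
elim: n {enL} => [|n IH]; first by rewrite big_ord_recr big_ord0 addn0 big_ord_recr /= leq_addl.
rewrite big_ord_recr /=; apply: leq_trans (leq_add IH (leqnn _)) _.
by rewrite doubleS !addnS [leqRHS]big_ord_recr /= leq_add2r [leqRHS]big_ord_recr /= leq_addr.
Qed.

(** On the parity class of [t], with alternating signs, the bound on iterates of [tsum] is one on
    [H]-th differences. At most [nb] points of the class are bad and at least [H] remain as
    nodes. *)
Lemma tsum_extrapolation (R : realFieldType) (f : int -> R) (a : int) (L H c nb : nat) (A D : R) :
  (0 < H)%N -> (L.+2 <= (c * H).*2)%N -> 0 <= D -> (1 <= L)%N ->
  ((H + nb).*2 <= L)%N ->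
  (\sum_(j < L.+1) ~~ (`|f (a + j%:Z)| <= A)%R <= nb)%N ->
  (forall t, a + H%:Z <= t -> t + H%:Z <= a + L%:Z -> `|iter H (@tsum R) f t| <= D) ->
  forall t, a <= t -> t <= a + L%:Z -> `|f t| <= (8 * c)%:R ^+ H * (A + D).
Proof.
move=> H0 Lc D0 L1 HL bad fD t at_ tL.
pose k := `|(t - a)%R|%N; pose e := odd k : nat.
have e1 : (e <= 1)%N by rewrite /e; case: (odd k).
have tE : t = a + e%:Z + 2 * (k./2)%:Z.
  have := odd_double_half k; rewrite -/e /k; lia.
have kL : (e + k./2.*2 <= L)%N.
  have := odd_double_half k; rewrite -/e /k; lia.
pose g (j : int) := (-1) ^+ `|j|%N * f (a + e%:Z + 2 * j).
have gf j : `|g j| = `|f (a + e%:Z + 2 * j)| by rewrite normrM normrX normrN1 expr1n mul1r.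
rewrite tE -gf.
pose n := (L - e)./2.
have nL : (e + n.*2 <= L)%N by rewrite /n; have := odd_double_half (L - e)%N; lia.
have nL' : (L <= e + n.*2.+1)%N by rewrite /n; have := odd_double_half (L - e)%N; case: (odd _); lia.
apply: (@bounded_extrapolation R g 0 n.+1 H c A D) => //.
- lia.
- have := @sum_class_le (fun j => ~~ (`|f (a + j%:Z)| <= A)) e n L nL.
  move=> /leq_trans/(_ bad) h.
  have gE (j : nat) : `|g (0 + j%:Z)| = `|f (a + (e + j.*2)%N%:Z)|.
    by rewrite gf; congr (`|f _|); lia.
  have {}h : (\sum_(j < n.+1) ~~ (`|g (0 + (j : nat)%:Z)| <= A)%R <= nb)%N.
    by apply: leq_trans h; apply: leq_sum => j _; rewrite gE.
  have := count_predC_ord (fun j => `|g (0 + j%:Z)| <= A) n.+1.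
  move: h; set x := (\sum_(j < n.+1) ~~ _)%N; set y := (\sum_(j < n.+1) _)%N.
  lia.
- move=> z z0 zn; rewrite iter_fdiff_alternate !normrM !normrX normrN1 !expr1n !mul1r.
  by apply: fD; lia.
- lia.
Qed.

(** Row [H] is extrapolated from its values of size at most [1]; the random walk bound fills the
    rows below it except within [H] of their ends, and a second extrapolation reaches the ends. The
    constant collects two factors [8 * c], a factor [5] and a factor [4]. *)
Lemma slab_le (R : realFieldType) (w : nat -> int -> R) (a : int) (L H c nb : nat) (B : R) :
  row_rec w -> 1 <= B -> (0 < H)%N -> (0 < c)%N -> (6 * H <= L)%N -> ((H + nb).*2 <= L)%N ->
  (L.+2 <= (c * H).*2)%N ->
  (forall t, a <= t -> t <= a + L%:Z -> `|w 0%N t| <= B /\ `|w 1%N t| <= B) ->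
  (\sum_(j < L.+1) ~~ (`|w H (a + j%:Z)| <= 1)%R <= nb)%N ->
  forall s t, (s <= H)%N -> a <= t -> t <= a + L%:Z ->
    `|w s t| <= (1280 * c ^ 2)%:R ^+ H * B.
Proof.
move=> wr B1 H0 c0 HL nbL Lc wB bad.
have B0 : 0 <= B by lra.
have D0 : 0 <= 5 ^+ H * B by rewrite mulr_ge0// exprn_ge0.
have wT s : (s <= H)%N -> forall t, a + H%:Z <= t -> t + H%:Z <= a + L%:Z ->
    `|iter H (@tsum R) (w s) t| <= 5 ^+ H * B.
  move=> sH t h h'; rewrite -(subnK sH) iterD.
  apply: (@le_trans _ _ (2 ^+ (H - s) * (5 ^+ s * B))).
    apply: (@iter_tsum_le _ _ _ (a + s%:Z) (a + L%:Z - s%:Z)); [|lia|lia].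
    by move=> t' k k'; apply: (iter_tsum_row_le wr wB); lia.
  rewrite addnC exprD mulrA (mulrC (2 ^+ _)) ler_wpM2r// ler_wpM2l ?exprn_ge0//.
  by apply: lerXn2r; rewrite ?nnegrE//; lra.
have wH := @tsum_extrapolation R (w H) a L H c nb 1 _ H0 Lc D0 _ nbL bad (wT H (leqnn H)).
set E := (8 * c)%:R ^+ H in wH.
have E1 : 1 <= E by apply: exprn_ege1; rewrite ler1n; lia.
have F1 : 1 <= 5 ^+ H :> R by apply: exprn_ege1; lra.
have {}wH t : a <= t -> t <= a + L%:Z -> `|w H t| <= E * (2 * (5 ^+ H * B)).
  move=> h h'; apply: le_trans (wH _ t h h') _; first lia.
  by rewrite ler_wpM2l; [|lra|nra].
set A := E * (2 * (5 ^+ H * B)) in wH.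
have A1 : 5 ^+ H * B <= A by rewrite /A; nra.
have BA : B <= A by apply: le_trans A1; nra.
have mid := @row_between_le R H H w a (a + L%:Z) A wr.
have {}mid s t : (s <= H)%N -> a + H%:Z <= t -> t + H%:Z <= a + L%:Z -> `|w s t| <= A.
  apply: mid => [t' h h'|s' t' s'H h h']; first by have [+ _] := wB t' h h'; have := wH t' h h'; split; lra.
  apply: le_trans (wT s' s'H t' h h') _; apply: le_trans A1 _.
  by rewrite ler_peMl ?exprn_ege1//; lra.
(* Each row has at most [2 * H] uncontrolled points, all near its ends; they are the bad points of
   the second extrapolation, whence [6 * H <= L]. *)
move=> s t sH h h'.
have := @tsum_extrapolation R (w s) a L H c H.*2 A _ H0 Lc D0 _ _ _ (wT s sH) t h h'.
move=> /(_ _ _ _)/le_trans; apply; [lia|lia| |].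
  have LE : L.+1 = (H + (L.+1 - H.*2) + H)%N by lia.
  rewrite LE !big_split_ord /= [X in (_ + X + _)%N]big1 ?addn0; last first.
    move=> i _; rewrite mid//; have := ltn_ord i; lia.
  rewrite -addnn leq_add//.
    by rewrite -[leqRHS]card_ord -sum1_card leq_sum// => i _; case: (_ <= _).
  by rewrite -[leqRHS]card_ord -sum1_card leq_sum// => i _; case: (_ <= _).
rewrite -/E; apply: (@le_trans _ _ (E * (E * (4 * (5 ^+ H * B))))).
  by rewrite ler_wpM2l//; [lra|rewrite /A in A1 *; lra].
have -> : (1280 * c ^ 2)%N = (8 * c * (8 * c) * (4 * 5))%N by lia.
rewrite natrM exprMn natrM exprMn -/E natrM exprMn -!mulrA.
rewrite ler_wpM2l ?(le_trans _ E1)// ler_wpM2l ?(le_trans _ E1)// ler_wpM2r//.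
apply: (@le_trans _ _ (4 ^+ 1 : R)); first by rewrite expr1.
by apply: ler_weXn2l; [lra|].
Qed.

(** * Densities of large values and growth of squares *)

Definition isum (F : int -> nat) (p : int) (n : nat) : nat :=
  (\sum_(j < n) F (p + (j : nat)%:Z)%R)%N.

Lemma leq_isum (F G : int -> nat) p n :
  (forall x, (F x <= G x)%N) -> (isum F p n <= isum G p n)%N.
Proof. by move=> FG; apply: leq_sum => j _. Qed.

Lemma isum_sub (F : int -> nat) (p p' : int) n n' :
  p <= p' -> p' + n'%:Z <= p + n%:Z -> (isum F p' n' <= isum F p n)%N.
Proof.
move=> pp' nn'.
have [k kE] : exists k : nat, p' = p + k%:Z by exists `|(p' - p)%R|%N; lia.
have -> : n = (k + n' + (n - k - n'))%N by lia.
rewrite /isum !big_split_ord /=; apply: leq_trans (leq_addr _ _).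
apply: leq_trans (leq_addl _ _); rewrite kE; apply: leq_sum => j _.
by rewrite PoszD addrA.
Qed.

Lemma isum_ge (F : int -> nat) (p x : int) n :
  p <= x -> x < p + n%:Z -> (F x <= isum F p n)%N.
Proof.
move=> px xn; apply: leq_trans (isum_sub (p' := x) (n' := 1) F px _); last lia.
by rewrite /isum big_ord_recr big_ord0 /= add0n addr0.
Qed.

Lemma isum_exchange (F : int -> int -> nat) p n q m :
  isum (fun s => isum (F s) q m) p n = isum (fun t => isum (fun s => F s t) p n) q m.
Proof. exact: exchange_big. Qed.

Lemma isum_opp (F : int -> nat) (h n : nat) : n = h.*2.+1 ->
  isum (fun x => F (- x)) (- h%:Z) n = isum F (- h%:Z) n.
Proof.
move=> ->; rewrite /isum (reindex_inj rev_ord_inj) /=; apply: eq_bigr => j _.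
by congr F; have := ltn_ord j; lia.
Qed.

Lemma isum_pigeonhole (F : int -> nat) p n k : (isum F p n < n * k.+1)%N ->
  exists2 j, (j < n)%N & (F (p + j%:Z)%R <= k)%N.
Proof.
move=> Fn; have [/existsP[j Fj]|/existsPn h] := boolP [exists j : 'I_n, (F (p + j%:Z)%R <= k)%N].
  by exists j.
move: Fn; rewrite ltnNge -[X in (X * _)%N]card_ord -sum_nat_const leq_sum// => j _.
by rewrite ltnNge h.
Qed.

(** Harmonicity in the rotated coordinates [s = n + m], [t = n - m]; the two parity classes of
    [s + t] do not interact. *)
Definition diag_harmonic (R : nzRingType) (v : int -> int -> R) :=
  forall s t, 4%:R * v s t = v (s + 1) (t + 1) + v (s + 1) (t - 1) +
                             v (s - 1) (t + 1) + v (s - 1) (t - 1).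

Definition large (R : realDomainType) (v : int -> int -> R) (s t : int) : nat :=
  ~~ (`|v s t| <= 1).

Definition large_count (R : realDomainType) (v : int -> int -> R) (r : nat) : nat :=
  isum (fun s => isum (large v s) (- r%:Z) r.*2.+1) (- r%:Z) r.*2.+1.

Lemma diag_harmonic_swap (R : realDomainType) (v : int -> int -> R) :
  diag_harmonic v -> diag_harmonic (fun s t => v t s).
Proof. by move=> vh s t; rewrite vh; ring. Qed.

Lemma diag_harmonic_opp (R : realDomainType) (v : int -> int -> R) :
  diag_harmonic v -> diag_harmonic (fun s t => v (- s) t).
Proof.
move=> vh s t; rewrite vh (_ : - s + 1 = - (s - 1)); last lia.
by rewrite (_ : - s - 1 = - (s + 1)); [ring|lia].
Qed.

Lemma large_count_swap (R : realDomainType) (v : int -> int -> R) r :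
  large_count (fun s t => v t s) r = large_count v r.
Proof. exact: isum_exchange. Qed.

Lemma large_count_opp (R : realDomainType) (v : int -> int -> R) r :
  large_count (fun s t => v (- s) t) r = large_count v r.
Proof. exact: (@isum_opp (fun s => isum (large v s) (- r%:Z) r.*2.+1)). Qed.

(** With [q = r %/ 16], one of the rows [r + q, ..., r + 2 * q - 1] has few large values. Together
    with the rows [r - 1] and [r] it controls a slab of height at most [2 * q] that covers the strip
    up to [r + q]. *)
Lemma side_expansion (R : realFieldType) :
  exists2 C : R, 1 <= C & forall (v : int -> int -> R) (r h : nat) (B : R),
  diag_harmonic v -> 1 <= B -> (16 <= r)%N -> (r <= h <= r.*2)%N ->
  (128 * large_count v r.*2 <= r ^ 2)%N ->
  (forall s t : int, r%:Z - 1 <= s -> s <= r%:Z -> `|t| <= h%:Z -> `|v s t| <= B) ->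
  forall s t : int, r%:Z <= s -> s <= (r + r %/ 16)%N%:Z -> `|t| <= h%:Z ->
    `|v s t| <= C ^+ (r %/ 16).*2 * B.
Proof.
pose C : R := (1280 * 128 ^ 2)%N%:R.
have C1 : 1 <= C by rewrite ler1n muln_gt0 expn_gt0.
exists C => // v r h B vh B1 r16 /andP[rh hr] few vB s t rs sq th.
set q := (r %/ 16)%N in sq *.
have q1 : (0 < q)%N by rewrite divn_gt0.
have rq : (r < 16 * q.+1)%N by rewrite mulnC ltn_ceil.
have qr : (16 * q <= r)%N by rewrite mulnC leq_trunc_div.
pose nb := (r %/ 4)%N.
have nb1 : (r < 4 * nb.+1)%N by rewrite mulnC ltn_ceil.
have nb2 : (4 * nb <= r)%N by rewrite mulnC leq_trunc_div.
have [j jq jnb] : exists2 j, (j < q)%N &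
    (isum (large v ((r + q)%N%:Z + j%:Z)%R) (- h%:Z)%R h.*2.+1 <= nb)%N.
  apply: (@isum_pigeonhole (fun s => isum (large v s) (- h%:Z) h.*2.+1)).
  apply: (@leq_ltn_trans (isum (fun s => isum (large v s) (- h%:Z) h.*2.+1) (- r.*2%:Z) r.*2.*2.+1)).
    by apply: isum_sub; lia.
  apply: (@leq_ltn_trans (large_count v r.*2)).
    by apply: leq_isum => x; apply: isum_sub; lia.
  by rewrite -(ltn_pmul2l (isT : (0 < 128)%N)); apply: leq_ltn_trans few _; nia.
pose w (i : nat) t := v (r%:Z - 1 + i%:Z) t.
have wr : row_rec w.
  move=> i x; rewrite /w /tsum vh.
  rewrite (_ : r%:Z - 1 + i.+1%:Z + 1 = r%:Z - 1 + i.+2%:Z); last lia.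
  by rewrite (_ : r%:Z - 1 + i.+1%:Z - 1 = r%:Z - 1 + i%:Z); [ring|lia].
pose H := (q + j.+1)%N.
have bad : (\sum_(i < h.*2.+1) ~~ (`|w H (- h%:Z + (i : nat)%:Z)| <= 1)%R <= nb)%N.
  move: jnb; rewrite /isum /large /w /H.
  by rewrite (_ : r%:Z - 1 + (q + j.+1)%N%:Z = (r + q)%N%:Z + j%:Z); [|lia].
have wB x : - h%:Z <= x -> x <= - h%:Z + h.*2%:Z -> `|w 0%N x| <= B /\ `|w 1%N x| <= B.
  by move=> x1 x2; split; apply: vB; lia.
pose i := `|(s - r%:Z + 1)%R|%N.
have -> : v s t = w i t by congr (v _ t); rewrite /i; lia.
apply: (@le_trans _ _ (C ^+ H * B)).
  by apply: (@slab_le R w (- h%:Z) h.*2 H 128 nb B wr B1 _ isT _ _ _ wB bad); rewrite /H /i; lia.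
rewrite ler_wpM2r ?(le_trans _ B1)//.
by apply: ler_weXn2l => //; rewrite /H; lia.
Qed.

(** Extend to both sides in [s], by reflection, then in [t], by exchanging the coordinates with
    half-width now [r + q]; each extension costs [C ^+ q.*2]. *)
Lemma square_expansion (R : realFieldType) :
  exists2 C : R, 1 <= C & forall (v : int -> int -> R) (r : nat) (B : R),
  diag_harmonic v -> 1 <= B -> (16 <= r)%N ->
  (128 * large_count v r.*2 <= r ^ 2)%N ->
  (forall s t : int, `|s| <= r%:Z -> `|t| <= r%:Z -> `|v s t| <= B) ->
  forall s t : int, `|s| <= (r + r %/ 16)%N%:Z -> `|t| <= (r + r %/ 16)%N%:Z ->
    `|v s t| <= C ^+ (r %/ 16) * B.
Proof.
have [C C1 CP] := side_expansion R.
exists (C ^+ 4); first by rewrite exprn_ege1.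
move=> v r B vh B1 r16 few vB.
set q := (r %/ 16)%N; have qr : (16 * q <= r)%N by rewrite mulnC leq_trunc_div.
have Cq1 : 1 <= C ^+ q.*2 by rewrite exprn_ege1.
have CB : B <= C ^+ q.*2 * B by rewrite ler_peMl//; lra.
have strip (u : int -> int -> R) (h : nat) (B' : R) : diag_harmonic u -> 1 <= B' ->
    (r <= h <= r.*2)%N -> (128 * large_count u r.*2 <= r ^ 2)%N ->
    (forall s t : int, `|s| <= r%:Z -> `|t| <= h%:Z -> `|u s t| <= B') ->
    forall s t : int, `|s| <= (r + q)%N%:Z -> `|t| <= h%:Z -> `|u s t| <= C ^+ q.*2 * B'.
  move=> uh B'1 rh ufew uB s t sr th.
  have [sr'|sr'] := lerP `|s| r%:Z.
    by apply: le_trans (uB s t sr' th) _; rewrite ler_peMl//; lra.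
  have [s0|s0] := lerP 0 s.
    by apply: (CP u r h B' uh) => //; [move=> s' t' h1 h2 h3; apply: uB; lia|lia|lia].
  rewrite -[s]opprK; apply: (CP (fun s t => u (- s) t) r h B') => //; [|rewrite large_count_opp//| |lia|lia].
    exact: diag_harmonic_opp.
  by move=> s' t' h1 h2 h3; apply: uB; lia.
move=> s t sr tr.
have -> : (C ^+ 4) ^+ q * B = C ^+ q.*2 * (C ^+ q.*2 * B).
  by rewrite -exprM mulrA -exprD; congr (C ^+ _ * B); lia.
apply: (@strip (fun s t => v t s) (r + q)%N (C ^+ q.*2 * B)) => //.
- exact: diag_harmonic_swap.
- lra.
- lia.
- by rewrite large_count_swap.
by move=> s' t' h1 h2; apply: (strip v r B) => //; lia.
Qed.

(** Strong induction on the radius: a square of radius [p], about [31 * r / 32], expands to radius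
    [r], and the cost [p %/ 16] in the exponent fits into [3 * (r - p)]. Up to radius [32] no value
    is large. *)
Lemma exp_growth_from_center (R : realFieldType) :
  exists2 C : R, 1 <= C & forall (v : int -> int -> R) (L : nat),
  diag_harmonic v ->
  large_count v 32 = 0%N ->
  (forall r, (r <= L)%N -> (128 * large_count v r.*2 <= r ^ 2)%N) ->
  forall (r : nat) (s t : int), (r <= L)%N -> `|s| <= r%:Z -> `|t| <= r%:Z ->
    `|v s t| <= C ^+ r.
Proof.
have [C C1 CP] := square_expansion R.
exists (C ^+ 3); first by rewrite exprn_ege1.
move=> v L vh v0 few; elim/ltn_ind => r IH s t rL sr tr.
have [r32|r32] := leqP r 32.
  apply: (@le_trans _ _ 1); last by rewrite exprn_ege1// exprn_ege1.
  have : (isum (large v s) (- 32%:Z)%R 32.*2.+1 <= large_count v 32)%N.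
    by apply: (@isum_ge (fun s => isum (large v s) (- 32%:Z) 32.*2.+1)); lia.
  rewrite v0 => h1.
  have : (large v s t <= 0)%N by apply: leq_trans h1; apply: isum_ge; lia.
  by rewrite /large; case: (_ <= _).
pose p := (r - r %/ 32)%N.
have pr : (p < r)%N by rewrite /p; lia.
apply: (@le_trans _ _ (C ^+ (p %/ 16) * (C ^+ 3) ^+ p)).
  apply: (CP v) => //; [|rewrite /p; lia|apply: few; lia| |rewrite /p; lia|rewrite /p; lia].
    by rewrite exprn_ege1// exprn_ege1.
  by move=> s' t' h1 h2; apply: IH => //; lia.
by rewrite -!exprM -exprD ler_weXn2l// /p; lia.
Qed.

(** * Centers of small density *)

Local Open Scope fset_scope.
Local Open Scope ring_scope.

Definition box (p : int) (n : nat) (q : int) (m : nat) : seq (int * int) :=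
  [seq (p + i%:Z, q + j%:Z) | i <- iota 0 n, j <- iota 0 m].

Lemma mem_box p n q m z : (z \in box p n q m) =
  [&& p <= z.1, z.1 < p + n%:Z, q <= z.2 & z.2 < q + m%:Z].
Proof.
apply/allpairsP/and4P => [[[i j] [/=]]|[]].
  rewrite !mem_iota => h1 h2 -> /=; split; lia.
case: z => x y /= h1 h2 h3 h4; exists (`|(x - p)%R|%N, `|(y - q)%R|%N) => /=.
split; [rewrite mem_iota; lia|rewrite mem_iota; lia|congr (_, _); lia].
Qed.

Lemma uniq_box p n q m : uniq (box p n q m).
Proof.
apply: allpairs_uniq; rewrite ?iota_uniq//.
by move=> [i j] [i' j'] _ _ [h1 h2]; congr (_, _); lia.
Qed.

Lemma size_box p n q m : size (box p n q m) = (n * m)%N.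
Proof. by rewrite size_allpairs !size_iota. Qed.

Lemma card_fset_box (X : {fset int * int}) (P : int -> int -> bool) p n q m :
  (forall z, (z \in X) = (z \in box p n q m) && P z.1 z.2) ->
  #|` X| = isum (fun s => isum (fun t => P s t) q m) p n.
Proof.
move=> XP; have -> : #|` X| = count (fun z => P z.1 z.2) (box p n q m).
  rewrite -size_filter; apply/perm_size/uniq_perm; rewrite ?filter_uniq ?uniq_box//.
  by move=> z; rewrite XP mem_filter andbC.
rewrite -sum1_count big_mkcond /= big_allpairs_dep /isum.
rewrite -(big_mkord xpredT (fun i => (\sum_(j < m) P (p + i%:Z)%R (q + j%:Z)%R)%N)) /index_iota subn0.
apply: eq_bigr => i _.
rewrite -(big_mkord xpredT (fun j => nat_of_bool (P (p + i%:Z)%R (q + j%:Z)%R))) /index_iota subn0.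
by apply: eq_bigr => j _; case: (P _ _).
Qed.

Definition in_ball (y : int * int) (r : nat) (z : int * int) : bool :=
  (`|z.1 - y.1| <= r%:Z) && (`|z.2 - y.2| <= r%:Z).

Lemma in_ballE y r z :
  in_ball y r z = (z \in box (y.1 - r%:Z) r.*2.+1 (y.2 - r%:Z) r.*2.+1).
Proof.
case: y z => [y1 y2] [z1 z2]; rewrite mem_box /in_ball /=.
by apply/andP/and4P => [[h1 h2]|[h1 h2 h3 h4]]; split; lia.
Qed.

Lemma card_ball_le (A : {fset int * int}) y r :
  (forall z, z \in A -> in_ball y r z) -> (#|` A| <= r.*2.+1 ^ 2)%N.
Proof.
move=> Ay; rewrite -mulnn -(size_box (y.1 - r%:Z) _ (y.2 - r%:Z)) uniq_leq_size//.
by move=> z /Ay; rewrite in_ballE.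
Qed.

Lemma seq_max_nat (T : eqType) (f : T -> nat) (s : seq T) : s != [::] ->
  exists2 y, y \in s & forall z, z \in s -> (f z <= f y)%N.
Proof.
elim: s => [//|x [|x' s] IH] _.
  by exists x; rewrite ?inE//; move=> z; rewrite inE => /eqP->.
have [//|y ys ymax] := IH.
have [xy|/ltnW yx] := leqP (f x) (f y).
  exists y; first by rewrite inE ys orbT.
  by move=> z; rewrite inE => /predU1P[->//|/ymax].
exists x; first by rewrite mem_head.
by move=> z; rewrite inE => /predU1P[->//|/ymax/leq_trans]; apply.
Qed.

(** Greedy selection: choose the ball of largest radius [r], drop the centers within [2 * r] of its
    center and the points of [B] inside it, and recurse. At most
    [(4 * r + 1) ^ 2 <= 4 * (2 * r + 1) ^ 2] centers are dropped. *)
Lemma vitali_covering (K : nat) (rad : int * int -> nat) (A B : {fset int * int}) :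
  (forall y, y \in A ->
    ((rad y).*2.+1 ^ 2 <= K * #|` [fset z in B | in_ball y (rad y) z]|)%N) ->
  (#|` A| <= 4 * K * #|` B|)%N.
Proof.
have [n] := ubnP #|` A|; elim: n => // n IH in A B *; rewrite ltnS => An AB.
have [->|A0] := eqVneq A fset0; first by rewrite cardfs0.
have [|y yA ymax] := @seq_max_nat _ rad (enum_fset A).
  by rewrite -size_eq0 cardfs_eq0.
set r := rad y in ymax.
pose A1 := [fset z in A | in_ball y r.*2 z]; pose A2 := A `\` A1.
pose B1 := [fset z in B | in_ball y r z]; pose B2 := B `\` B1.
have A1A : A1 `<=` A by apply/fsubsetP => z; rewrite !inE => /andP[].
have B1B : B1 `<=` B by apply/fsubsetP => z; rewrite !inE => /andP[].
have Asum : (#|` A1| + #|` A2| = #|` A|)%N.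
  by rewrite cardfsDS// subnKC// fsubset_leq_card.
have Bsum : (#|` B1| + #|` B2| = #|` B|)%N.
  by rewrite cardfsDS// subnKC// fsubset_leq_card.
have A1le : (#|` A1| <= 4 * K * #|` B1|)%N.
  apply: (@leq_trans (r.*2.*2.+1 ^ 2)).
    by apply: (@card_ball_le _ y) => z; rewrite !inE => /andP[].
  have := AB y yA; rewrite -/r -/B1; nia.
have A1gt : (0 < #|` A1|)%N.
  by rewrite cardfs_gt0; apply/fset0Pn; exists y; rewrite !inE yA /in_ball !subrr.
have A2le : (#|` A2| <= 4 * K * #|` B2|)%N.
  apply: IH; first by move: Asum An A1gt; lia.
  move=> x; rewrite !inE negb_and => /andP[h xA].
  apply: leq_trans (AB x xA) _; rewrite leq_mul2l; apply/orP; right.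
  apply: fsubset_leq_card; apply/fsubsetP => z; rewrite !inE => /andP[zB zx].
  (* A point common to the balls of [x] and [y] would put [x] within [2 * r] of [y], since no radius
     exceeds [r]. *)
  rewrite zB zx !andbT /=; apply/negP => zy.
  move: h; rewrite xA /=; have := ymax x xA; move: zx zy; rewrite /in_ball; lia.
by move: A1le A2le; rewrite -Asum -Bsum; nia.
Qed.

Definition translate (T : Type) (v : int -> int -> T) (y : int * int) (s t : int) : T :=
  v (y.1 + s) (y.2 + t).

(* The weak (1,1) bound for the maximal function of the indicator of the large values. *)
Lemma sparse_center (R : realDomainType) (v : int -> int -> R) (K a l : nat) :
  (3 * a <= l)%N -> (4 * K * large_count v l < a.*2.+1 ^ 2)%N ->
  exists2 y : int * int, in_ball (0, 0) a y &
    forall r, (r <= a.*2)%N -> (K * large_count (translate v y) r < r.*2.+1 ^ 2)%N.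
Proof.
(* If every center were dense at some scale, these balls would violate the covering bound;
   [3 * a <= l] keeps them inside the square where large values are counted. *)
move=> al few; apply: contrapT => dense.
have /choice[rad radP] : forall y : int * int, exists r, in_ball (0, 0) a y ->
    (r <= a.*2)%N /\ (r.*2.+1 ^ 2 <= K * large_count (translate v y) r)%N.
  move=> y; have [ya|nya] := boolP (in_ball (0, 0) a y); last by exists 0%N.
  apply: contrapT => h; apply: dense; exists y => // r ra.
  by rewrite ltnNge; apply/negP => h'; apply: h; exists r.
pose A := [fset z in box (0 - a%:Z) a.*2.+1 (0 - a%:Z) a.*2.+1].
pose B := [fset z in box (- l%:Z) l.*2.+1 (- l%:Z) l.*2.+1 | ~~ (`|v z.1 z.2| <= 1)].
have zA z : (z \in A) = in_ball (0, 0) a z by rewrite in_fset in_ballE.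
have zB z : (z \in B) = (z \in box (- l%:Z) l.*2.+1 (- l%:Z) l.*2.+1) && ~~ (`|v z.1 z.2| <= 1).
  by rewrite in_fset.
have cA : #|` A| = (a.*2.+1 ^ 2)%N.
  by rewrite card_fseq undup_id ?uniq_box// size_box mulnn.
have cB : #|` B| = large_count v l by apply: card_fset_box.
move: few; rewrite ltnNge => /negP; apply; rewrite -cA -cB.
apply: (@vitali_covering K rad) => y; rewrite zA => ya.
have [r1 r2] := radP y ya; apply: leq_trans r2 _; rewrite leq_mul2l; apply/orP; right.
rewrite (@card_fset_box _ (fun s t => ~~ (`|v s t| <= 1)) (y.1 - (rad y)%:Z) (rad y).*2.+1
  (y.2 - (rad y)%:Z) (rad y).*2.+1).
  apply: leq_sum => i _; apply: leq_sum => j _; rewrite /large /translate !addrA//.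
move=> z; rewrite in_fset -[LHS]/((z \in B) && in_ball y (rad y) z) zB -in_ballE.
rewrite andbC andbA; case zr : (in_ball _ _ z) => //=.
suff -> : z \in box (- l%:Z) l.*2.+1 (- l%:Z) l.*2.+1 by [].
move: (rad y) r1 zr ya => r ra; rewrite mem_box /in_ball.
case: (y) (z) => [y1 y2] [z1 z2] /= /andP[h1 h2] /andP[h3 h4].
by apply/and4P; split; lia.
Qed.

(** Growth starts from a sparse center at distance at most [a = l %/ 4] from the origin and reaches
    the origin at radius [a]. *)
Lemma exp_bound_of_sparse (R : realFieldType) :
  exists2 C : R, 1 <= C & exists K : nat, forall (v : int -> int -> R) (l : nat),
  diag_harmonic v -> (64 <= l)%N -> (K * large_count v l <= l ^ 2)%N ->
  `|v 0 0| <= C ^+ l.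
Proof.
have [C C1 CP] := exp_growth_from_center R.
(* The square of radius [32] has [65 ^ 2] points, so density below [1 / K] leaves no large value in
   it. The other bound combines the factor [128] with [(4 * r + 1) ^ 2 <= 25 * r ^ 2] for
   [r >= 1]. *)
have [K K65 K3200] : exists2 K : nat, (65 ^ 2 <= K)%N & (128 * 25 <= K)%N.
  by exists (maxn (65 ^ 2) (128 * 25)); rewrite (leq_maxl, leq_maxr).
exists C => //; exists (16 * (4 * K))%N => v l vh l64 few.
pose a := (l %/ 4)%N.
have al : (4 * a <= l)%N by rewrite mulnC leq_trunc_div.
have la : (l < 4 * a.+1)%N by rewrite mulnC ltn_ceil.
have [||y ya ysparse] := @sparse_center R v K a l; first lia.
  rewrite -(ltn_pmul2l (isT : (0 < 16)%N)) mulnA; apply: leq_ltn_trans few _.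
  by rewrite -!mulnn; nia.
have -> : v 0 0 = translate v y (- y.1) (- y.2) by rewrite /translate !subrr.
apply: (@le_trans _ _ (C ^+ a)); last by rewrite ler_weXn2l//; lia.
have h0 : diag_harmonic (translate v y).
  by move=> s t; rewrite /translate vh !addrA.
have h1 : large_count (translate v y) 32 = 0%N.
  have h := ysparse 32 ltac:(lia); apply/eqP; rewrite -leqn0 leqNgt; apply/negP => x0.
  by move: h; rewrite ltnNge (leq_trans K65)// leq_pmulr.
have h2 r : (r <= a)%N -> (128 * large_count (translate v y) r.*2 <= r ^ 2)%N.
  move=> ra; have := ysparse r.*2 ltac:(lia); move: (large_count _ _) => x xr.
  case: r ra xr => [|r] ra xr.
    by case: x xr => [//|x]; rewrite ltnNge (leq_trans _ (leq_pmulr _ _)) ?(leq_trans _ K65).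
  have r25 : ((r.+1.*2).*2.+1 ^ 2 <= 25 * r.+1 ^ 2)%N by rewrite -!mulnn; nia.
  rewrite -(leq_pmul2l (isT : (0 < 25)%N)); apply: leq_trans r25; apply: leq_trans (ltnW xr).
  by rewrite mulnA leq_mul2r mulnC K3200 orbT.
move: ya; rewrite /in_ball /= !subr0 => /andP[y1 y2].
by apply: (CP _ a h0 h1 h2) => //; lia.
Qed.

Local Close Scope fset_scope.

(** * Gradient estimate *)

Definition harmonic2 (R : nzRingType) (U : int -> int -> R) :=
  forall n m, 4%:R * U n m = U (n + 1) m + U (n - 1) m + U n (m + 1) + U n (m - 1).

Lemma harmonic2_swap (R : realDomainType) (U : int -> int -> R) :
  harmonic2 U -> harmonic2 (fun n m => U m n).
Proof. by move=> Uh n m; rewrite Uh; ring. Qed.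

Lemma harmonic2_opp (R : realDomainType) (U : int -> int -> R) :
  harmonic2 U -> harmonic2 (fun n m => - U n m).
Proof. by move=> Uh n m; have := Uh n m; lra. Qed.

Lemma harmonic2_translate (R : realDomainType) (U : int -> int -> R) y :
  harmonic2 U -> harmonic2 (translate U y).
Proof. by move=> Uh n m; rewrite /translate Uh !addrA. Qed.

Lemma harmonic2_fdiff (R : realDomainType) (U : int -> int -> R) :
  harmonic2 U -> harmonic2 (fun n m => fdiff (U ^~ m) n).
Proof.
move=> Uh n m; have := Uh n m; have := Uh (n + 1) m; rewrite /fdiff.
by rewrite (_ : n - 1 + 1 = n + 1 - 1); [lra|lia].
Qed.

(* Reflection in the line [n = 1/2] turns the first difference into a harmonic
   function odd in that line; [b] is a strictly superharmonic barrier for it. *)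
Lemma gradient_at_0_le (R : realFieldType) (U : int -> int -> R) (r : nat) (M : R) :
  harmonic2 U -> (0 < r)%N -> 0 < M ->
  (forall n m : int, `|n| <= r%:Z -> `|m| <= r%:Z -> `|U n m| <= M) ->
  U 1 0 - U 0 0 <= 4 * M / r%:R.
Proof.
move=> Uh r0 M0 UM.
have rR : 1 <= r%:R :> R by rewrite ler1n.
pose w (i j : int) := U i j - U (1 - i) j.
pose b (i j : int) : R := (4 * i%:~R - 2) * r%:R - 2 * i%:~R * (i%:~R - 1) + j%:~R ^+ 2.
pose F i j := r%:R ^+ 2 * w i j - 2 * M * b i j.
(* The barrier has Laplacian [-2], which makes [F] strictly subharmonic. *)
have FL i j : 4 * F i j = F (i + 1) j + F (i - 1) j + F i (j + 1) + F i (j - 1) - 4 * M.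
  rewrite /F /b /w.
  rewrite (_ : 1 - (i + 1) = 1 - i - 1); last lia.
  rewrite (_ : 1 - (i - 1) = 1 - i + 1); last lia.
  have := Uh i j; have := Uh (1 - i) j; rewrite !rmorphD !rmorphN /= => h1 h2.
  have : 4 * (U i j - U (1 - i) j) = (U (i + 1) j - U (1 - i - 1) j) + (U (i - 1) j - U (1 - i + 1) j)
     + (U i (j + 1) - U (1 - i) (j + 1)) + (U i (j - 1) - U (1 - i) (j - 1)) by lra.
  move: (U i j - U (1 - i) j) (U (i + 1) j - U (1 - i - 1) j) (U (i - 1) j - U (1 - i + 1) j).
  move: (U i (j + 1) - U (1 - i) (j + 1)) (U i (j - 1) - U (1 - i) (j - 1)).
  move=> c d e f g h.
  nra.
have wM (i j : int) : 1 <= i -> i <= r%:Z -> `|j| <= r%:Z -> w i j <= 2 * M.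
  move=> i1 ir jr; rewrite /w.
  have := UM i j ltac:(lia) jr; have := UM (1 - i) j ltac:(lia) jr.
  by rewrite !ler_norml; lra.
pose I := ('I_r * 'I_r.*2.+1)%type.
pose G (p : I) := F (p.1.+1)%:Z ((p.2 : nat)%:Z - r%:Z).
have FG (i j : int) : 1 <= i -> i <= r%:Z -> `|j| <= r%:Z -> exists p : I, F i j = G p.
  move=> i1 ir jr.
  have h1 : (`|(i - 1)%R|%N < r)%N by lia.
  have h2 : (`|(j + r%:Z)%R|%N < r.*2.+1)%N by lia.
  by exists (Ordinal h1, Ordinal h2); rewrite /G /=; congr F; lia.
have [p00 F10] := FG 1 0 ltac:(lia) ltac:(lia) ltac:(lia).
have [p _ pmax] := @arg_maxP _ _ I p00 xpredT G isT.
have Fmax (i j : int) : 1 <= i -> i <= r%:Z -> `|j| <= r%:Z -> F i j <= G p.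
  by move=> h1 h2 h3; have [q ->] := FG i j h1 h2 h3; exact: pmax.
(* At [(1, 0)] the barrier equals [2 * r], so [F <= 0] there is the claimed bound. *)
suff Gp0 : G p <= 0.
  have := Fmax 1 0 ltac:(lia) ltac:(lia) ltac:(lia); rewrite /F /w /b subrr.
  rewrite ler_pdivlMr ?ltr0n// => h; rewrite -(ler_pM2l (x := r%:R)) ?ltr0n//; nra.
rewrite leNgt; apply/negP => Gp.
have [i [j [i1 ir jr GF]]] : exists i j : int, [/\ 1 <= i, i <= r%:Z, `|j| <= r%:Z & G p = F i j].
  exists (p.1.+1)%:Z, ((p.2 : nat)%:Z - r%:Z); split => //; move: (ltn_ord p.1) (ltn_ord p.2); lia.
rewrite GF in Gp Fmax.
have iR1 : 1 <= i%:~R :> R by rewrite -(ler_int R) in i1.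
have iR2 : i%:~R <= r%:R :> R by rewrite -[leRHS]mulrz_nat ler_int natz.
(* On the sides [|j| = r] and [i = r] the barrier is at least [r ^ 2] while [w <= 2 * M], so no
   positive maximum is attained there. *)
have [jr'|jr'] := eqVneq `|j| r%:Z.
  have jj : j%:~R ^+ 2 = r%:R ^+ 2 :> R.
    by rewrite -[LHS]ger0_norm ?sqr_ge0// normrX -intr_norm jr'.
  have := wM i j i1 ir jr; move: Gp; rewrite /F /b jj => h1 h2.
  have : 0 <= (4 * i%:~R - 2) * r%:R - 2 * i%:~R * (i%:~R - 1) :> R by nra.
  nra.
have [ir'|ir'] := eqVneq i r%:Z.
  have ii : i%:~R = r%:R :> R by rewrite ir'.
  have := wM i j i1 ir jr; move: Gp; rewrite /F /b ii => h1 h2.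
  have : 0 <= j%:~R ^+ 2 :> R by exact: sqr_ge0.
  nra.
have := FL i j.
have [g1 g2 g3 g4] : [/\ 1 <= i + 1, i + 1 <= r%:Z, `|j + 1| <= r%:Z & `|j - 1| <= r%:Z].
  split; move: i1 ir jr ir' jr'; clear; lia.
have f1 := Fmax _ _ g1 g2 jr; have f2 := Fmax _ _ i1 ir g3; have f3 := Fmax _ _ i1 ir g4.
suff f4 : F (i - 1) j <= F i j by move: (FL i j) M0 f1 f2 f3 f4; clear; lra.
(* For [i = 1] the left neighbour lies across the reflection line, where oddness of [w] gives a
   value at most [- F 1 j], hence negative. *)
have [ii|ii] := eqVneq i 1; last by apply: Fmax => //; move: i1 ir ii; clear; lia.
have wodd : w 0 j = - w 1 j by rewrite /w subr0 subrr opprB.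
apply: (@le_trans _ _ (- F i j)); last by move: Gp; clear; lra.
rewrite ii subrr /F wodd /b; have : 0 <= j%:~R ^+ 2 :> R by exact: sqr_ge0.
by move: M0; clear; nra.
Qed.

Lemma gradient_le (R : realFieldType) (U : int -> int -> R) (r : nat) (M : R) (n m : int) :
  harmonic2 U -> (0 < r)%N -> 0 < M ->
  (forall i j : int, `|i - n| <= r%:Z -> `|j - m| <= r%:Z -> `|U i j| <= M) ->
  `|fdiff (U ^~ m) n| <= 4 * M / r%:R.
Proof.
move=> Uh r0 M0 UM; pose V := translate U (n, m).
have Vh : harmonic2 V by exact: harmonic2_translate.
have VM i j : `|i| <= r%:Z -> `|j| <= r%:Z -> `|V i j| <= M.
  by move=> ir jr; apply: UM; rewrite addrC addKr.
have := gradient_at_0_le Vh r0 M0 VM.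
have := gradient_at_0_le (harmonic2_opp Vh) r0 M0.
rewrite /V /translate /= !addr0 -/(fdiff (U ^~ m) n) => h1 h2.
rewrite ler_norml h2 andbT lerNl; apply: le_trans (h1 _) => [|i j ir jr].
  by rewrite /fdiff; lra.
by rewrite normrN; exact: VM.
Qed.

(** Differences stay harmonic, so the gradient bound iterates: each order costs a factor [4 / r] and
    a margin [r]. *)
Lemma iter_fdiff_harmonic_le (R : realFieldType) k (U : int -> int -> R) (r : nat) (M : R)
    (a b c d : int) :
  harmonic2 U -> (0 < r)%N -> 0 < M ->
  (forall i j : int, a <= i -> i <= b -> c <= j -> j <= d -> `|U i j| <= M) ->
  forall i j : int, a + (k * r)%N%:Z <= i -> i <= b - (k * r)%N%:Z ->
    c + (k * r)%N%:Z <= j -> j <= d - (k * r)%N%:Z ->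
  `|iter k (@fdiff R) (U ^~ j) i| <= (4 / r%:R) ^+ k * M.
Proof.
move=> + r0; elim: k U M a b c d => [|k IH] U M a b c d Uh M0 UM i j ai ib cj jd.
  by rewrite expr0 mul1r; apply: UM; lia.
have r4 : 0 < 4 / r%:R :> R by rewrite divr_gt0// ltr0n.
rewrite iterSr exprSr -mulrA.
apply: (IH (fun n m => fdiff (U ^~ m) n) _ (a + r%:Z) (b - r%:Z) (c + r%:Z) (d - r%:Z)).
- exact: harmonic2_fdiff.
- by rewrite mulr_gt0.
- move=> i' j' h1 h2 h3 h4; rewrite mulrAC; apply: gradient_le => // i'' j'' h5 h6.
  by apply: UM; move: h1 h2 h3 h4 h5 h6; clear; lia.
- move: ai; clear; rewrite mulSn; lia.
- move: ib; clear; rewrite mulSn; lia.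
- move: cj; clear; rewrite mulSn; lia.
- move: jd; clear; rewrite mulSn; lia.
Qed.

(** Liouville's argument: the gradient bound holds at every radius, and the radius is arbitrary. *)
Lemma bounded_harmonic2_step (R : realType) (U : int -> int -> R) (M : R) (n m : int) :
  harmonic2 U -> (forall n m, `|U n m| <= M) -> U (n + 1) m = U n m.
Proof.
move=> Uh UM; have M0 : 0 < M + 1 by have := normr_ge0 (U 0 0); have := UM 0 0; lra.
apply/eqP; rewrite -subr_eq0 -normr_le0 leNgt; apply/negP => d0.
set e : R := `|_| in d0; have h0 : 0 <= 4 * (M + 1) / e by rewrite divr_ge0 ?(ltW d0)//; lra.
have := archi_boundP h0; set k := Num.Def.archi_bound _ => ke.
have k0 : (0 < k)%N by rewrite -(ltr0n R) (le_lt_trans h0).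
have : e <= 4 * (M + 1) / k%:R.
  by apply: gradient_le => // i j _ _; apply: le_trans (UM i j) _; lra.
by rewrite ler_pdivlMr ?ltr0n// leNgt [e * _]mulrC -ltr_pdivrMr// ke.
Qed.

Lemma bounded_harmonic2_const (R : realType) (U : int -> int -> R) (M : R) :
  harmonic2 U -> (forall n m, `|U n m| <= M) -> forall n m, U n m = U 0 0.
Proof.
move=> Uh UM.
have const1 (V : int -> int -> R) : harmonic2 V -> (forall n m, `|V n m| <= M) ->
    forall n m, V n m = V 0 m.
  move=> Vh VM n m; have pos (k : nat) : V k%:Z m = V 0 m /\ V (- k%:Z) m = V 0 m.
    elim: k => [|k [IH1 IH2]]; first by rewrite oppr0.
    rewrite -(bounded_harmonic2_step (- k.+1%:Z) m Vh VM).
    rewrite (_ : - k.+1%:Z + 1 = - k%:Z); last by rewrite -addn1 PoszD opprD addrNK.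
    by rewrite -addn1 PoszD (bounded_harmonic2_step _ _ Vh VM).
  have [n0|n0] := lerP 0 n; first by rewrite -(gez0_abs n0); case: (pos `|n|%N).
  by rewrite -[n]opprK -(ltz0_abs n0); case: (pos `|n|%N).
move=> n m; rewrite (const1 U)//.
by apply: (const1 (fun n m => U m n)) => //; exact: harmonic2_swap.
Qed.

(** * Interpolation of slowly growing harmonic functions *)

(** Gradient radius [16 * S] makes the remainder at most [S ^ (2k) * (4 / (16 * S)) ^ (2k) * 2 ^ k
    <= 1]. The [2k] differences use a margin of at most [16 * W] around points within [2 * W],
    whence [18 * W]; [m] is chosen so that [W %/ E <= m * S] bounds the bad points. *)
Lemma harmonic_centered_le (R : realFieldType) (U : int -> int -> R) (k W E S m : nat) (A : R) (x y : int) :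
  harmonic2 U -> (0 < k)%N -> 1 <= A -> (2 <= E)%N ->
  S = (W %/ k.*2)%N -> (0 < S)%N -> m = ((4 * k) %/ E).+1 ->
  (forall i j : int, `|i| <= (18 * W)%N%:Z -> `|j| <= (18 * W)%N%:Z -> `|U i j| <= 2 ^+ k) ->
  `|x| <= W%:Z -> `|y| <= W.*2%:Z ->
  (isum (fun i => ~~ (`|U i y| <= A)%R) (- W.*2%:Z)%R W.*2.*2.+1 <= W %/ E)%N ->
  `|U x y| <= 'C(k + m, k)%:R ^+ 2 * (k.*2.+1)%:R * A.
Proof.
move=> Uh k0 A1 E2 SE S0 mE UM xW yW bad.
have SW : (k.*2 * S <= W)%N by rewrite SE mulnC leq_trunc_div.
have WS : (W < k.*2 * S.+1)%N by rewrite SE mulnC ltn_ceil// double_gt0.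
have EW : (E * (W %/ E) <= W)%N by rewrite mulnC leq_trunc_div.
have mW : (W %/ E <= m * S)%N.
  have h : (4 * k < E * m)%N by rewrite mE [ltnRHS]mulnC ltn_ceil//; lia.
  rewrite -(leq_pmul2l (ltac:(lia) : (0 < E)%N)) mulnA; apply: leq_trans EW _.
  by apply: ltnW; apply: leq_trans WS _; nia.
have badx (e : bool) : (\sum_(j < W) ~~ (`|U (x + (-1) ^+ e * (j.+1)%:Z) y| <= A)%R <= W %/ E)%N.
  apply: leq_trans bad; case: e.
    apply: (@leq_trans (isum (fun i => ~~ (`|U i y| <= A)%R) (x - W%:Z)%R W)); last by apply: isum_sub; lia.
    rewrite /isum (reindex_inj rev_ord_inj) /=; apply: leq_sum => j _.
    rewrite (_ : x + -1 * _ = x - W%:Z + (j : nat)%:Z)//.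
    by have := ltn_ord j; move: (j : nat) => j'; clear; lia.
  apply: (@leq_trans (isum (fun i => ~~ (`|U i y| <= A)%R) (x + 1)%R W)); last by apply: isum_sub; lia.
  apply: leq_sum => j _; rewrite (_ : x + 1 * _ = x + 1 + (j : nat)%:Z)//.
  by move: (j : nat) => j'; clear; lia.
pose D : R := (4 / (16 * S)%N%:R) ^+ k.*2 * 2 ^+ k.
have SR : 0 < S%:R :> R by rewrite ltr0n.
have D0 : 0 <= D by rewrite mulr_ge0// exprn_ge0// divr_ge0.
have DS : S%:R ^+ k.*2 * D <= 1.
  rewrite /D mulrA -exprMn natrM (_ : S%:R * _ = (1 / 4)); last by field; rewrite gt_eqF.
  rewrite -muln2 exprM exprAC -exprMn exprn_ile1//; lra.
have := @centered_interpolation R (U ^~ y) x W k S m A D S0 D0.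
move=> /(_ _ _ _ _)/le_trans; apply; first lra.
- move=> e; have := badx e; have := count_predC_ord (fun j => `|U (x + (-1) ^+ e * (j.+1)%:Z) y| <= A) W.
  set g := (\sum_(j < W) _)%N; set b := (\sum_(j < W) ~~ _)%N; nia.
- by move=> e; exact: leq_trans (badx e) mW.
- move=> z z1 z2; rewrite /D.
  apply: (@iter_fdiff_harmonic_le R k.*2 U (16 * S) (2 ^+ k) (- (18 * W)%N%:Z) (18 *
    W)%N%:Z (- (18 * W)%N%:Z) (18 * W)%N%:Z) => //.
  + by rewrite muln_gt0.
  + by rewrite exprn_gt0.
  + by move=> i j h1 h2 h3 h4; apply: UM; lia.
  + by move: SW z1 z2 xW; clear; nia.
  + by move: SW z1 z2 xW; clear; nia.
  + by move: SW yW; clear; nia.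
  + by move: SW yW; clear; nia.
rewrite -mulrA ler_wpM2l ?exprn_ge0//.
by rewrite -addn1 natrD mulrDl mul1r lerD//; lra.
Qed.

(** Interpolate twice: first along rows with at most [W %/ E] large values, then along the column of
    [x] with the resulting bound [A] as threshold. More than [W %/ E] exceptional rows would give
    too many large values in all. *)
Lemma harmonic_square_le (R : realFieldType) (U : int -> int -> R) (k W E m : nat) :
  harmonic2 U -> (0 < k)%N -> (2 <= E)%N -> (k.*2 <= W)%N -> m = ((4 * k) %/ E).+1 ->
  (forall i j : int, `|i| <= (18 * W)%N%:Z -> `|j| <= (18 * W)%N%:Z -> `|U i j| <= 2 ^+ k) ->
  (E ^ 2 * large_count U W.*2 <= W ^ 2)%N ->
  forall x y : int, `|x| <= W%:Z -> `|y| <= W%:Z ->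
  `|U x y| <= (('C(k + m, k) ^ 2 * k.*2.+1) ^ 2)%N%:R.
Proof.
move=> Uh k0 E2 kW mE UM few x y xW yW.
pose S := (W %/ k.*2)%N.
have S0 : (0 < S)%N by rewrite divn_gt0// double_gt0.
pose A : R := 'C(k + m, k)%:R ^+ 2 * (k.*2.+1)%:R.
have A1 : 1 <= A.
  rewrite /A -natrX -natrM ler1n muln_gt0 expn_gt0 bin_gt0; lia.
pose n (y : int) := isum (fun i => large U i y) (- W.*2%:Z) W.*2.*2.+1.
have row (j : int) : (n j <= W %/ E)%N -> `|j| <= W.*2%:Z -> `|U x j| <= A.
  move=> nj jW; rewrite -[A]mulr1.
  exact: (@harmonic_centered_le R U k W E S m 1 x j).
have -> : (('C(k + m, k) ^ 2 * k.*2.+1) ^ 2)%N%:R = A * A.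
  by rewrite /A -mulnn natrM natrM natrX.
apply: (@harmonic_centered_le R (fun i j => U j i) k W E S m A y x) => //.
- exact: harmonic2_swap.
- by move=> i j hi hj; exact: UM.
- by move: xW; clear; lia.
rewrite leqNgt; apply/negP => many.
suff : (W ^ 2 < E ^ 2 * large_count U W.*2)%N by rewrite ltnNge few.
have WE : (W < E * (W %/ E).+1)%N by rewrite mulnC ltn_ceil; lia.
apply: (@leq_trans (E ^ 2 * ((W %/ E).+1 * (W %/ E).+1))).
  by rewrite mulnn -expnMn ltn_exp2r.
rewrite leq_mul2l /large_count isum_exchange; apply/orP; right.
apply: (@leq_trans ((W %/ E).+1 * isum (fun i => ~~ (`|U x i| <= A)%R) (- W.*2%:Z)%R W.*2.*2.+1)).
  by rewrite leq_mul2l many orbT.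
rewrite mulnC /isum big_distrl /=; apply: leq_sum => j _.
have [//|UA] := boolP (`|U x _| <= A); rewrite mul1n ltnNge; apply: contra UA => h.
apply: row => //; have := ltn_ord j; move: (j : nat) => j'; clear; lia.
Qed.

(** * Subexponential binomial coefficients *)

(** Bernoulli's inequality for the power [j] of [1 - 1 / (X + 1)], in a form free of fractions. *)
Lemma leq_exp_succ j X : (j <= X)%N -> (X.+1 ^ j * (X - j) <= X ^ j.+1)%N.
Proof.
elim: j => [|j IH] jX; first by rewrite expn0 mul1n subn0 expn1.
apply: (@leq_trans (X * (X.+1 ^ j * (X - j)))).
  rewrite expnS -mulnA [leqRHS]mulnCA [leqLHS]mulnCA leq_mul2l; apply/orP; right.
  by rewrite -(subnSK jX); nia.
by rewrite [leqRHS]expnS leq_mul2l IH ?orbT// ltnW.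
Qed.

(** The left side is a single term of the binomial expansion of [(X + 1) ^ (k + m)]. *)
Lemma bin_mul_exp_le k m X : ('C(k + m, k) * X ^ k <= X.+1 ^ (k + m))%N.
Proof.
rewrite -addn1 expnDn (bigD1 (Ordinal (ltac:(lia) : (m < (k + m).+1)%N)))//=.
by rewrite exp1n muln1 addnK -[X in (X * _ <= _)%N]bin_sub ?leq_addr// addKn leq_addr//.
Qed.

(** For [X = 4 * a], Bernoulli bounds the power [2 * a] of [(X + 1) / X] by [2], so the [k] factors
    cost [2 ^ k]; the [m] remaining factors [e] cost at most [2 ^ (e * m) <= 2 ^ (k + e)]. A square
    root then leaves one [2 ^ k]. *)
Lemma bin_subexponential a : (0 < a)%N ->
  exists2 E, (2 <= E)%N & exists C, forall k, ('C(k + ((4 * k) %/ E).+1, k) ^ a <= C * 2 ^ k)%N.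
Proof.
move=> a0; pose X := (4 * a)%N; pose e := (X.+1 ^ (2 * a))%N.
have e0 : (0 < e)%N by rewrite expn_gt0.
exists (4 * e)%N; first by lia.
exists (2 ^ e)%N => k; rewrite divnMl//; set m := (k %/ e).+1; set b := 'C(_, _).
have X2 : (X.+1 ^ (2 * a) <= 2 * X ^ (2 * a))%N.
  have := @leq_exp_succ (2 * a) X ltac:(rewrite /X; lia).
  rewrite expnS (_ : X - 2 * a = 2 * a)%N; last by rewrite /X; lia.
  move: (X.+1 ^ _)%N (X ^ _)%N => x y; rewrite /X => h.
  by rewrite -(@leq_pmul2r (2 * a)) ?muln_gt0//; apply: leq_trans h _; nia.
have em : (e * m <= k + e)%N.
  by rewrite /m mulnS addnC leq_add2r mulnC leq_trunc_div.
have main : (b ^ (2 * a) * (X ^ (2 * a)) ^ k <= 2 ^ (2 * k + e) * (X ^ (2 * a)) ^ k)%N.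
  have -> : (b ^ (2 * a) * (X ^ (2 * a)) ^ k = (b * X ^ k) ^ (2 * a))%N.
    by rewrite expnMn -!expnM [(k * _)%N]mulnC.
  apply: (@leq_trans ((X.+1 ^ (k + m)) ^ (2 * a))).
    by rewrite leq_exp2r ?muln_gt0// bin_mul_exp_le.
  have -> : ((X.+1 ^ (k + m)) ^ (2 * a) = e ^ k * e ^ m)%N.
    by rewrite -expnD -!expnM mulnC.
  apply: (@leq_trans ((2 * X ^ (2 * a)) ^ k * (2 ^ e) ^ m)).
    apply: leq_mul; first by case: (k) => // k'; rewrite leq_exp2r.
    by rewrite leq_exp2r// ltnW// ltn_expl.
  rewrite expnMn mulnAC leq_mul2r; apply/orP; right.
  by rewrite -expnM -expnD leq_exp2l//; lia.
rewrite leq_pmul2r ?expn_gt0 in main; last by rewrite muln_gt0 a0.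
rewrite -leq_sqr -expnM mulnC; apply: leq_trans main _.
by rewrite -expnD -expnM leq_exp2l//; lia.
Qed.

Lemma exp_dominates_power p : (0 < p)%N -> exists C, forall n, (n ^ p <= C * 2 ^ n)%N.
Proof.
move=> p0; exists (p ^ p)%N => n.
have h : (n <= p * 2 ^ (n %/ p))%N.
  apply: ltnW; apply: leq_trans (ltn_ceil n p0) _; rewrite mulnC leq_mul2l.
  by rewrite ltn_expl ?orbT.
apply: (@leq_trans ((p * 2 ^ (n %/ p)) ^ p)); first by rewrite leq_exp2r.
by rewrite expnMn leq_mul2l -expnM leq_exp2l// leq_trunc_div orbT.
Qed.

Lemma interpolation_constant_subexponential p : (0 < p)%N ->
  exists2 E, (2 <= E)%N & exists C, forall k, (0 < k)%N ->
    ((('C(k + ((4 * k) %/ E).+1, k) ^ 2 * k.*2.+1) ^ 2) ^ p <= C * 2 ^ k)%N.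
Proof.
move=> p0; have [E E2 [C CP]] := @bin_subexponential (8 * p) ltac:(lia).
have [C' CP'] := @exp_dominates_power (4 * p) ltac:(lia).
exists E => //; exists (C * (3 ^ (4 * p) * C'))%N => k k0.
set b := 'C(_, _); have b8 : (b ^ (8 * p) <= C * 2 ^ k)%N by exact: CP.
have k4 : (k.*2.+1 ^ (4 * p) <= 3 ^ (4 * p) * C' * 2 ^ k)%N.
  apply: (@leq_trans ((3 * k) ^ (4 * p))); first by rewrite leq_exp2r; lia.
  by rewrite expnMn -mulnA leq_mul2l CP' orbT.
have C0 : (0 < C * (3 ^ (4 * p) * C'))%N.
  rewrite !muln_gt0 expn_gt0 /=; apply/andP; split.
    by move: b8; case: C {CP} => // ; rewrite mul0n leqn0 expn_eq0 -leqn0 leqNgt bin_gt0 leq_addr.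
  by have := CP' 1%N; rewrite exp1n; case: C' {CP' k4}.
set c := (C * (_ * _))%N in C0 *.
(* Squaring provides two factors [2 ^ k], one for the binomial coefficient and one for the
   polynomial factor. *)
rewrite -leq_sqr; apply: (@leq_trans (c * 2 ^ k * 2 ^ k)).
  rewrite -expnM -expnM expnMn -expnM.
  rewrite (_ : 2 * (2 * (p * 2)) = 8 * p)%N; last lia.
  rewrite (_ : 2 * (p * 2) = 4 * p)%N; last lia.
  by apply: leq_trans (leq_mul b8 k4) _; rewrite mulnACA /c !mulnA.
by rewrite expnMn -mulnA -mulnn leq_mul// leq_pmulr.
Qed.

(** * From sparse large values to constancy *)

(** The parity class not reached by the rotation is filled with [0], which is harmonic there and
    never large. *)
Definition rotate (R : zmodType) (U : int -> int -> R) (s t : int) : R :=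
  if (2 %| s + t)%Z then U ((s + t) %/ 2)%Z ((s - t) %/ 2)%Z else 0.

Lemma rotateE (R : zmodType) (U : int -> int -> R) (s t a b : int) :
  s = a + b -> t = a - b -> rotate U s t = U a b.
Proof.
move=> -> ->; rewrite /rotate (_ : (2 %| a + b + (a - b))%Z = true); last lia.
by congr (U _ _); lia.
Qed.

Lemma even_sum_split (s t : int) : (2 %| s + t)%Z -> exists a b : int, s = a + b /\ t = a - b.
Proof. by move=> st; exists ((s + t) %/ 2)%Z, ((s - t) %/ 2)%Z; lia. Qed.

Lemma rotate_diag_harmonic (R : realDomainType) (U : int -> int -> R) :
  harmonic2 U -> diag_harmonic (rotate U).
Proof.
move=> Uh s t; have [/even_sum_split[a [b [-> ->]]]|odd_st] := boolP (2 %| s + t)%Z.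
  rewrite (@rotateE _ U _ _ a b)// (@rotateE _ U _ _ (a + 1) b); [|lia|lia].
  rewrite (@rotateE _ U _ _ a (b + 1)); [|lia|lia].
  rewrite (@rotateE _ U _ _ a (b - 1)); [|lia|lia].
  by rewrite (@rotateE _ U _ _ (a - 1) b); [rewrite Uh; ring|lia|lia].
rewrite /rotate (negbTE odd_st) ifF; last lia.
by rewrite ifF ?ifF ?ifF; [ring|lia|lia|lia].
Qed.

(** Large values sit on the even class, and halving [s + t] and [s - t] maps them injectively into
    the square of the same radius. *)
Lemma large_count_rotate (R : realDomainType) (U : int -> int -> R) l :
  (large_count (rotate U) l <= large_count U l)%N.
Proof.
pose X (V : int -> int -> R) : {fset int * int} :=
  [fset z in box (- l%:Z) l.*2.+1 (- l%:Z) l.*2.+1 | ~~ (`|V z.1 z.2| <= 1)]%fset.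
have zX V z : (z \in X V) = (z \in box (- l%:Z) l.*2.+1 (- l%:Z) l.*2.+1) && ~~ (`|V z.1 z.2| <= 1).
  by rewrite in_fset.
have XE V : large_count V l = #|` X V| by symmetry; apply: (card_fset_box (P := fun s t
  => ~~ (`|V s t| <= 1))) => z; exact: zX.
rewrite !XE; pose f (z : int * int) := (z.1 + z.2, z.1 - z.2).
apply: (@leq_trans #|` (f @` X U)%fset|); last exact: leq_imfset_card.
apply: fsubset_leq_card; apply/fsubsetP => -[s t]; rewrite zX mem_box /= => /andP[/and4P[h1 h2 h3 h4]].
have [/even_sum_split[a [b [sE tE]]]|odd_st] := boolP (2 %| s + t)%Z; last first.
  by rewrite /rotate (negbTE odd_st) normr0 ler01.
rewrite (rotateE _ sE tE) sE tE => Uab; apply/imfsetP; exists (a, b) => //=.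
have -> // : (a, b) \in X U.
rewrite zX mem_box Uab andbT /=; move: h1 h2 h3 h4; rewrite sE tE; clear.
by move=> h1 h2 h3 h4; apply/and4P; split; lia.
Qed.

Lemma large_count_translate (R : realDomainType) (U : int -> int -> R) y l L :
  `|y.1| + l%:Z <= L%:Z -> `|y.2| + l%:Z <= L%:Z ->
  (large_count (translate U y) l <= large_count U L)%N.
Proof.
case: y => y1 y2 /= y1L y2L; rewrite /large_count.
apply: (@leq_trans (isum (fun s => isum (large U s) (y2 - l%:Z) l.*2.+1) (y1 - l%:Z) l.*2.+1)).
  by apply: leq_sum => i _; apply: leq_sum => j _; rewrite /large /translate !addrA.
apply: (@leq_trans (isum (fun s => isum (large U s) (y2 - l%:Z) l.*2.+1) (- L%:Z) L.*2.+1)).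
  by apply: isum_sub; lia.
by apply: leq_isum => s; apply: isum_sub; lia.
Qed.

Lemma le_exp2_archi (R : realType) (C : R) : exists e : nat, C <= 2 ^+ e.
Proof.
exists (Num.Def.archi_bound `|C|); apply: le_trans (ler_norm _) _.
apply/ltW/(lt_le_trans (archi_boundP (normr_ge0 _))).
by rewrite -natrX ler_nat ltnW// ltn_expl.
Qed.

(** Use the bound [C ^ l] around each point at the small scale [l = N %/ D], where [D] exceeds [q]
    times the binary logarithm of [C]. Writing rates as [q]-th powers avoids real roots. *)
Lemma small_exponential_growth (R : realType) (q : nat) : (0 < q)%N ->
  exists2 K : nat, (0 < K)%N & forall (U : int -> int -> R) (N0 : nat), harmonic2 U ->
  (forall N, (N0 <= N)%N -> (K * large_count U N <= N ^ 2)%N) ->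
  exists N1 : nat, forall N (x y : int), (N1 <= N)%N -> `|x| <= N%:Z -> `|y| <= N%:Z ->
    `|U x y| ^+ q <= 2 ^+ N.
Proof.
move=> q0; have [C C1 [K CP]] := exp_bound_of_sparse R.
have [e Ce] := le_exp2_archi C.
pose D := (q * e.+1)%N; have D0 : (0 < D)%N by rewrite muln_gt0 q0.
exists (K * (16 * D ^ 2)).+1 => // U N0 Uh few.
exists (maxn N0 (64 * D)) => N x y; rewrite geq_max => /andP[NN0 ND] xN yN.
pose l := (N %/ D)%N.
have l64 : (64 <= l)%N by rewrite leq_divRL.
have lN : (D * l <= N)%N by rewrite mulnC leq_trunc_div.
have Nl : (N <= 2 * D * l)%N.
  by have := ltn_ceil N D0; rewrite -/l; move: l64; clear; nia.
pose v := rotate (translate U (x, y)).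
have lN' : (l <= N)%N by rewrite leq_div.
have vU : (large_count v l <= large_count U N.*2)%N.
  apply: leq_trans (large_count_rotate _ _) _; apply: large_count_translate => /=;
    move: xN yN lN'; clear; lia.
have : `|v 0 0| <= C ^+ l.
  apply: CP => //; first exact/rotate_diag_harmonic/harmonic2_translate.
  have := few N.*2 ltac:(lia); move: vU; set L := large_count v l; set L' := large_count U _ => vU few'.
  (* Density is known at radius [2 * N], and [N <= 2 * D * l] turns it into density at scale [l] at
     the price of [16 * D ^ 2]. *)
  rewrite -(@leq_pmul2r (16 * D ^ 2)) ?muln_gt0 ?expn_gt0 ?muln_gt0 ?q0//.
  apply: (@leq_trans (N.*2 ^ 2)).
    by apply: leq_trans few'; rewrite mulnAC mulSn (leq_trans _ (leq_addl _ _))// leq_mul2l vU orbT.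
  rewrite (_ : l ^ 2 * _ = (4 * D * l) ^ 2)%N; last by rewrite !expnMn; lia.
  by rewrite leq_exp2r//; move: Nl; clear; lia.
have -> : v 0 0 = U x y by rewrite /v (@rotateE _ _ 0 0 0 0)// /translate /= !addr0.
move=> h.
apply: (@le_trans _ _ ((C ^+ l) ^+ q)); first by apply: lerXn2r; rewrite ?nnegrE ?exprn_ge0//; lra.
rewrite -exprM; apply: (@le_trans _ _ ((2 ^+ e) ^+ (l * q))).
  by apply: lerXn2r; rewrite ?nnegrE ?exprn_ge0//; lra.
rewrite -exprM ler_weXn2l//; first lra.
by apply: leq_trans lN; rewrite /D; nia.
Qed.

(** On the square of radius [18 * N] the growth gives [2 ^ k] with [k] about [18 * N / q], and
    interpolation improves this to roughly the 36th root of [2 ^ k]; as [36 = 2 * 18], the rate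
    [1 / q] is halved. The term [c.+1] is large enough to absorb the constants, and [72 <= q]
    ensures [2 * k <= N]. *)
Lemma growth_halving (R : realType) (U : int -> int -> R) (N1 q E c : nat) :
  harmonic2 U -> (72 <= q)%N -> (4 * c.+2 <= N1)%N -> (2 <= E)%N ->
  (forall k, (0 < k)%N ->
    ((('C(k + ((4 * k) %/ E).+1, k) ^ 2 * k.*2.+1) ^ 2) ^ 36 <= 2 ^ c * 2 ^ k)%N) ->
  (forall N, (N1 <= N)%N -> (E ^ 2 * large_count U N.*2 <= N ^ 2)%N) ->
  (forall N (x y : int), (N1 <= N)%N -> `|x| <= N%:Z -> `|y| <= N%:Z ->
    `|U x y| ^+ q <= 2 ^+ (N + c.+1 * q)) ->
  forall N (x y : int), (N1 <= N)%N -> `|x| <= N%:Z -> `|y| <= N%:Z ->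
    `|U x y| ^+ (2 * q) <= 2 ^+ (N + c.+1 * (2 * q)).
Proof.
move=> Uh q72 cN1 E2 Ec few growth N x y NN xN yN.
have q0 : (0 < q)%N by apply: leq_trans q72.
have two : 1 <= 2 :> R by lra.
pose k := ((18 * N) %/ q + c.+2)%N.
have kq : (18 * N + c.+1 * q <= k * q)%N.
  have := ltn_ceil (18 * N) q0; rewrite /k; set d := (_ %/ _)%N; clear; nia.
have qk : (k * q <= 18 * N + c.+2 * q)%N.
  have := leq_trunc_div (18 * N) q; rewrite /k; set d := (_ %/ _)%N; clear; nia.
have kN : (k.*2 <= N)%N.
  have : ((18 * N) %/ q <= (18 * N) %/ 72)%N by apply: leq_div2l.
  by rewrite /k; move: cN1 NN; clear; lia.
set m := ((4 * k) %/ E).+1.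
pose Z := (('C(k + m, k) ^ 2 * k.*2.+1) ^ 2)%N.
have UZ : `|U x y| <= Z%:R.
  apply: (@harmonic_square_le R U k N E m) => //.
  - by rewrite /k addnS.
  - move=> i j hi hj; rewrite -(@ler_pXn2r _ q)// ?nnegrE ?exprn_ge0//.
    apply: le_trans (growth _ _ _ _ hi hj) _; first by move: NN; clear; lia.
    by rewrite -exprM ler_weXn2l.
  - exact: few.
rewrite -(@ler_pXn2r _ 18)// ?nnegrE ?exprn_ge0//.
apply: (@le_trans _ _ (((Z ^ 36) ^ q)%N%:R)).
  rewrite -expnM natrX -exprM (_ : 2 * q * 18 = 36 * q)%N; last by clear; lia.
  by apply: lerXn2r; rewrite ?nnegrE.
apply: (@le_trans _ _ (((2 ^ c * 2 ^ k) ^ q)%N%:R)).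
  by rewrite ler_nat leq_exp2r// Ec// /k addnS.
rewrite -expnD -expnM natrX -exprM ler_weXn2l//.
by move: qk; clear; nia.
Qed.

Lemma sparse_harmonic2_const (R : realType) :
  exists2 K : nat, (0 < K)%N & forall (U : int -> int -> R) (N0 : nat), harmonic2 U ->
  (forall N, (N0 <= N)%N -> (K * large_count U N <= N ^ 2)%N) ->
  forall n m, U n m = U 0 0.
Proof.
have [K1 K10 growth] := @small_exponential_growth R 72 isT.
have [E E2 [C CP]] := @interpolation_constant_subexponential 36 isT.
have Ec k : (0 < k)%N ->
    ((('C(k + ((4 * k) %/ E).+1, k) ^ 2 * k.*2.+1) ^ 2) ^ 36 <= 2 ^ C * 2 ^ k)%N.
  by move=> k0; apply: leq_trans (CP k k0) _; rewrite leq_mul2r ltnW ?orbT// ltn_expl.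
pose K2 := (4 * E ^ 2)%N; exists (maxn K1 K2); first by rewrite leq_max K10.
move=> U N0 Uh few.
have [|N1 N1P] := growth U N0 Uh.
  by move=> N NN; apply: leq_trans (few N NN); rewrite leq_mul2r leq_maxl orbT.
pose N2 := maxn (maxn N0 N1) (4 * C.+2).
have few2 N : (N2 <= N)%N -> (E ^ 2 * large_count U N.*2 <= N ^ 2)%N.
  rewrite !geq_max => /andP[/andP[n0 n1] n2]; rewrite -(@leq_pmul2l 4)// mulnA.
  apply: (@leq_trans (N.*2 ^ 2)); last by rewrite -muln2 expnMn mulnC.
  apply: leq_trans (few N.*2 _); last by lia.
  by rewrite leq_mul2r leq_maxr orbT.
(* Neither the starting radius [N2] nor the constant [2 ^ C.+1] depends on the number [j] of
   halvings. *)
have all j : forall N (x y : int), (N2 <= N)%N -> `|x| <= N%:Z -> `|y| <= N%:Z ->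
    `|U x y| ^+ (2 ^ j * 72) <= 2 ^+ (N + C.+1 * (2 ^ j * 72)).
  elim: j => [|j IH].
    move=> N x y; rewrite !geq_max => /andP[/andP[n0 n1] n2] xN yN.
    rewrite mul1n; apply: le_trans (N1P N x y n1 xN yN) _.
    by rewrite ler_weXn2l ?leq_addr//; lra.
  rewrite expnS -mulnA; apply: growth_halving Ec few2 IH => //.
    by rewrite leq_pmull// expn_gt0.
  by rewrite leq_max leqnn orbT.
apply: (@bounded_harmonic2_const R U (2 ^+ C.+2)) => // x y.
(* The radius is fixed first; [N] halvings then suffice, since [N <= 2 ^ N] makes the remaining
   exponential at most [2]. *)
pose N := maxn N2 (maxn `|x|%N `|y|%N).
have Q0 : (0 < 2 ^ N * 72)%N by rewrite muln_gt0 expn_gt0.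
rewrite -(@ler_pXn2r _ (2 ^ N * 72))// ?nnegrE ?exprn_ge0//.
have xN : `|x| <= N%:Z by rewrite -abszE lez_nat !leq_max leqnn !orbT.
have yN : `|y| <= N%:Z by rewrite -abszE lez_nat !leq_max leqnn !orbT.
apply: le_trans (all N N x y (leq_maxl _ _) xN yN) _.
rewrite -exprM ler_weXn2l//; first lra.
rewrite mulSn leq_add2r; apply: leq_trans (leq_pmulr _ _) => //.
by rewrite ltnW// ltn_expl.
Qed.

(** * Translation to the sets of the statement *)

Local Open Scope classical_set_scope.
Local Open Scope ring_scope.

Lemma num_points_square (P : int -> int -> bool) (N : nat) (A : set (int * int)) :
  (forall z, A z <-> P z.1 z.2) ->
  num_points (square N `&` A) =
  isum (fun s => isum (fun t => P s t) (- N%:Z) N.*2.+1) (- N%:Z) N.*2.+1.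
Proof.
move=> AP; apply: card_fset_box => z.
rewrite in_fset_set; last exact/finite_setIl/finite_square.
apply/idP/idP; rewrite mem_box inE.
  move=> [[/= h1 h2] /AP Pz]; rewrite Pz andbT; case: z h1 h2 {Pz} => [x y] /= h1 h2.
  by apply/and4P; split; lia.
move=> /andP[h Pz]; split; last exact/AP.
by case: z h {Pz} => [x y] /= /and4P[h1 h2 h3 h4]; split => /=; lia.
Qed.

Theorem theorem1p1 (R : realType) :
  exists eps : R, 0 < eps < 1 /\
    forall u : int * int -> R,
      discrete_harmonic u ->
      (exists N0 : R, 0 < N0 /\
        forall N : nat, N0 <= N%:R ->
          (1 - eps) * (num_points (square N))%:R
            <= (num_points (square N `&` sublevel u))%:R) ->
      exists c : R, forall p : int * int, u p = c.
Proof.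
have [K K0 KP] := sparse_harmonic2_const R.
(* The factor [10] pays for [(2 * N + 1) ^ 2 <= 10 * N ^ 2], valid for [N >= 1], when the count is
   compared with [N ^ 2] instead of the size of the square. *)
pose eps : R := (K * 10)%N%:R^-1.
have eps0 : 0 < eps by rewrite invr_gt0 ltr0n muln_gt0 K0.
exists eps; split.
  by rewrite eps0 /= invf_lt1 ?ltr1n ?ltr0n; lia.
move=> u uh [N0 [N00 few]].
exists (u (0, 0)) => -[n m].
pose U i j := u (i, j).
apply: (KP U (Num.Def.archi_bound N0)) => [i j|N NN]; first exact: uh.
have N0N : N0 <= N%:R.
  by apply/ltW/(lt_le_trans (archi_boundP (ltW N00))); rewrite ler_nat.
have N1 : (0 < N)%N by rewrite -(ltr0n R) (lt_le_trans N00).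
have := few N N0N.
rewrite -[square N in X in X <= _]setIT (@num_points_square (fun _ _ => true)); last by [].
rewrite (@num_points_square (fun s t => `|U s t| <= 1)); last by case.
have -> : isum (fun _ => isum (fun _ => true) (- N%:Z) N.*2.+1) (- N%:Z) N.*2.+1 = (N.*2.+1 ^ 2)%N.
  by rewrite /isum !sum_nat_const !card_ord muln1 mulnn.
set g := isum _ _ _.
have gl : (g + large_count U N = N.*2.+1 ^ 2)%N.
  rewrite /g /large_count /isum -big_split /= (eq_bigr (fun=> N.*2.+1)).
    by rewrite sum_nat_const card_ord mulnn.
  move=> i _; rewrite -big_split /= (eq_bigr (fun=> 1%N)) ?sum_nat_const ?card_ord ?muln1//.
  by move=> j _; rewrite /large; case: (_ <= _).
rewrite -gl => h.
have {}h : (large_count U N)%:R <= eps * (g + large_count U N)%N%:R.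
  by move: h; rewrite natrD; lra.
have K10 : 0 < (K * 10)%N%:R :> R by rewrite ltr0n muln_gt0 K0.
move: h; rewrite gl mulrC ler_pdivlMr// -natrM ler_nat => h.
rewrite -(@leq_pmul2r 10)//; apply: (@leq_trans (N.*2.+1 ^ 2)).
  by rewrite mulnAC mulnC.
by move: N1; clear; rewrite -!mulnn; nia.
Qed.
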